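(* Let $0<\alpha<1$, let $k\ge 1$ be an integer, let $\lambda_1,\dots,\lambda_k>0$, and let $\{M^{\alpha}(t)\}_{t\ge0}$ be the generalized fractional counting process (GFCP) with these parameters. Then the one-dimensional distributions of $\{M^{\alpha}(t)\}_{t\ge0}$ are not infinitely divisible; that is, for every $t>0$ the distribution of $M^{\alpha}(t)$ is not infinitely divisible.
   Context: The generalized fractional counting process (GFCP) $\{M^\alpha(t)\}_{t\ge0}$ with parameters $\alpha$ and $\lambda_1,\dots,\lambda_k>0$ has non-negative integer values and its state probabilities $p^\alpha(n,t)=\mathrm{Pr}\{M^\alpha(t)=n\}$ satisfy, with $\Lambda=\lambda_1+\dots+\lambda_k$, $$\frac{\mathrm{d}^{\alpha}}{\mathrm{d}t^{\alpha}}p^\alpha(n,t)=-\Lambda p^\alpha(n,t)+\sum_{j=1}^{\min\{n,k\}}\lambda_{j}p^\alpha(n-j,t),\quad n\ge0,$$ with $p^\alpha(0,0)=1$ and $p^\alpha(n,0)=0$ for $n\ge1$, where for $0<\alpha<1$ the Caputo derivative is $\frac{\mathrm{d}^{\alpha}}{\mathrm{d}t^{\alpha}}f(t)=\frac{1}{\Gamma(1-\alpha)}\int_0^t (t-s)^{-\alpha}f'(s)\,\mathrm{d}s$. Equivalently, $M^\alpha(t)\overset{d}{=}M(Y_\alpha(t))$, where $\{M(t)\}_{t\ge0}$ is the compound Poisson process with jumps of sizes $1,\dots,k$ occurring at rates $\lambda_1,\dots,\lambda_k$ respectively, and $\{Y_\alpha(t)\}_{t\ge0}$ is an independent inverse $\alpha$-stable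 subordinator: $Y_\alpha(t)=\inf\{x>0: D_\alpha(x)>t\}$, where $\{D_\alpha(t)\}_{t\ge0}$ is the non-decreasing Lévy process with $\mathbb{E}(e^{-sD_\alpha(t)})=e^{-ts^\alpha}$, $s>0$. *)

(* Defs.v *)
From HB Require Import structures.
From mathcomp Require Import all_boot all_order all_algebra.
From mathcomp Require Import all_classical all_reals all_analysis.

Set Implicit Arguments.
Unset Strict Implicit.
Unset Printing Implicit Defensive.

Import Order.TTheory GRing.Theory Num.Theory.
Import numFieldNormedType.Exports.

Local Open Scope classical_set_scope.
Local Open Scope ring_scope.

Definition Gamma {R : realType} (z : R) : R :=
  \int[lebesgue_measure]_(x in `]0, +oo[) (x `^ (z - 1) * expR (- x)).

Definition caputo_integrand {R : realType} (alpha : R) (f : R -> R) (t : R)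
    : R -> R :=
  fun s => (t - s) `^ (- alpha) * (f^`())%classic s.

(* [Rintegral] is total: the value is meaningful only for functions
   satisfying [caputo_derivable] below. *)
Definition caputo {R : realType} (alpha : R) (f : R -> R) (t : R) : R :=
  (Gamma (1 - alpha))^-1 *
  \int[lebesgue_measure]_(s in `]0, t[) caputo_integrand alpha f t s.

(* Conditions under which the Caputo derivative is defined at every t > 0.
   f' need not exist at 0: for the state probabilities of the process it blows
   up like t^(alpha - 1) there. *)
Definition caputo_derivable {R : realType} (alpha : R) (f : R -> R) : Prop :=
  [/\ f x @[x --> 0^'+] --> f 0,
      forall t, 0 < t -> derivable f t 1 &
      forall t, 0 < t -> lebesgue_measure.-integrable `]0, t[
        (EFin \o caputo_integrand alpha f t)].

Definition state_prob {d} {T : measurableType d} {R : realType}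
    {P : probability T R} (M : R -> {RV P >-> R}) (n : nat) (t : R) : R :=
  fine (P (M t @^-1` [set n%:R])).

(* The rate lambda_j of jumps of size j, 1 <= j <= k, is [lam] at the ordinal
   j - 1.  The system holds for t > 0: at t = 0 the integral defining the Caputo
   derivative is over an empty interval.  Only the times t >= 0 of [M] are
   constrained. *)
Record is_GFCP {d} {T : measurableType d} {R : realType} {P : probability T R}
    (alpha : R) (k : nat) (lam : 'I_k -> R) (M : R -> {RV P >-> R}) : Prop := {
  GFCP_nat : forall t w, 0 <= t -> M t w \is a Num.nat;
  GFCP_caputo_derivable : forall n, caputo_derivable alpha (state_prob M n);
  GFCP_system : forall n t, 0 < t ->
    caputo alpha (state_prob M n) t =
      - (\sum_(j < k) lam j) * state_prob M n t
      + \sum_(j < k | (j.+1 <= n)%N) lam j * state_prob M (n - j.+1) t;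
  GFCP_init : forall n, state_prob M n 0 = (n == 0)%:R
}.

Definition convolution {R : realType} (mu nu : set R -> \bar R) (A : set R)
    : \bar R :=
  (\int[mu]_x nu [set y | A (x + y)%R])%E.

Definition convolution_power {R : realType} (nu : set R -> \bar R) (n : nat)
    : set R -> \bar R :=
  iter n (convolution nu) (\d_(0 : R)).

Definition infinitely_divisible {R : realType} (mu : probability R R) : Prop :=
  forall n : nat, (0 < n)%N ->
  exists nu : probability R R,
    forall A : set R, measurable A -> mu A = convolution_power nu n A.

(* Main.v *)
From HB Require Import structures.
Require Import Defs.
From mathcomp Require Import all_boot all_order all_algebra.
From mathcomp Require Import all_classical all_reals all_analysis.
From mathcomp Require Import measurable_realfun ring lra zify.

(** Notation: w(u) = lambda_1 u + ... + lambda_k u^k - Lambda, tau = t^alpha, p_n is the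
    probability that M(t) = n, G(u) = sum_n p_n u^n, and E(x) = sum_n x^n / Gamma(alpha n + 1)
    is the Mittag-Leffler function.

    The generating function.  A fractional integration turns the Caputo system into Volterra
    equations with kernel (t - s)^(alpha - 1) ([volterra]).  The right-hand side of the system
    multiplies generating functions by w, so the Picard iterates of these equations have the
    partial sums of E(tau w(u)) as generating functions; since 0 <= p_n <= 1, the iterates
    converge to the state probabilities ([picard_error]).  Hence G(u) = E(tau w(u)) for every
    real u ([generating_function]), and G is entire.  Moreover p_0 > 0: the system makes the
    Caputo derivative of p_0 vanish at a zero of p_0, but a non-negative function with a
    positive initial value has a negative one at its zeros ([caputo_at_zero_lt0]).

    Infinite divisibility.  Convolution roots of the law of M(t) live on the non-negative
    integers and charge 0, so the N-th root of G is a power series with coefficients in [0, 1].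
    Letting N tend to infinity shows that the coefficients r_n of G'/G are non-negative
    ([log_deriv_ge0]).

    Growth.  For u >= 0 this gives G' >= r_j u^j G, so r_j > 0 makes G grow at least like
    exp(c u^(j+1)).  But E(v^alpha) lies between multiples of exp(v/4) and exp(2v)
    ([ml_lower], [ml_upper]), so that the growth of G is of order exactly k/alpha.  Hence
    r_j = 0 for j + 1 > k/alpha, so G = p_0 exp(H) with H a polynomial, and the order k/alpha
    must be the degree of H: it is an integer m, alpha m = k ([exponent_eq]).

    Contradiction.  Because alpha m = k, the functional equation of Gamma shows that
    prod_(l < k) (alpha x d/dx - l) maps E to x^m E + q with a polynomial q of degree less than
    m ([euler_equation]); q is not 0, since m > 1 and its coefficient at x is
    prod_(l < k) (alpha - l) / Gamma(alpha + 1).  On the other hand G = E(tau w) satisfies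
    G' = (polynomial) G, so the chain rule expresses the value at tau w of any such operator
    applied to E, up to a power of w', as a polynomial times G ([euler_polyE]).  Comparing the
    two expressions gives X1 G = w'^(2k) q(tau w) for some polynomial X1.  As G grows faster
    than all polynomials, X1 = 0, hence q = 0, which is absurd ([linear_ode_absurd]). *)

Set Implicit Arguments.
Unset Strict Implicit.
Unset Printing Implicit Defensive.

Import Order.TTheory GRing.Theory Num.Theory.
Import numFieldNormedType.Exports.

Local Open Scope classical_set_scope.
Local Open Scope ring_scope.

(** * Integrating the derivative of an everywhere differentiable function *)

Section DerivativeIntegral.
Context {R : realType}.
Local Notation mu := (@lebesgue_measure R).
Implicit Types (f g : R -> R) (a b c x y z : R).

(** Differentiability at z controls the chords that end at z, on either side; the supremum
    argument of [increment_le_integral] only ever uses such chords. *)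
Lemma derivable_increment_le f z c : derivable f z 1 -> f^`()%classic z < c ->
  exists2 e : R, 0 < e & forall x y, z - e < x -> y < z + e ->
    x <= z <= y -> (x == z) || (y == z) -> f y - f x <= c * (y - x).
Proof.
move=> df dfc.
have cv : (fun h => h^-1 *: (f (h + z) - f z)) @ 0^' --> f^`()%classic z.
  rewrite derive1E /derive.
  have <- : (fun h : R => h^-1 *: ((f \o shift z) (h *: 1) - f z)) =
      (fun h : R => h^-1 *: (f (h + z) - f z)).
    by apply/funext => h /=; rewrite -[h *: 1]/(h * 1) mulr1.
  exact: df.
have : \forall h \near 0^', h^-1 *: (f (h + z) - f z) < c.
  exact: cvgr_lt cv _ dfc.
move=> [e /= e0 H]; exists e => // x y xe ye /andP[xz zy] /orP[] /eqP E.
- subst x; move: zy; rewrite le_eqVlt => /predU1P[->|zy]; first by rewrite !subrr mulr0.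
  have := H (y - z); rewrite /ball /= sub0r normrN gtr0_norm ?subr_gt0// => /(_ _ _).
  rewrite subrK -[_ *: _]/(_ * _) mulrC ltr_pdivrMr ?subr_gt0//.
  by move=> h; apply/ltW/h; [lra | apply/eqP; lra].
- subst y; move: xz; rewrite le_eqVlt => /predU1P[->|xz]; first by rewrite !subrr mulr0.
  have := H (x - z); rewrite /ball /= sub0r normrN ltr0_norm ?subr_lt0// => /(_ _ _).
  rewrite subrK -[_ *: _]/(_ * _) mulrC ltr_ndivrMr ?subr_lt0//.
  move=> h; have : c * (x - z) < f x - f z by apply: h; [lra | apply/eqP; lra].
  by lra.
Qed.

(** The points y where the inequality holds on [x, y] contain their supremum and can be
    continued a little beyond it, so the supremum is b.  The local lower bounds c > f' z express
    that G is lower semicontinuous and exceeds f'; they replace continuity of f'. *)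
Lemma increment_le_integral f (G : R -> \bar R) x b :
  measurable_fun [set: R] G -> (forall z, 0 <= G z)%E ->
  (forall z, x <= z <= b -> exists2 c : R, f^`()%classic z < c /\ derivable f z 1 &
     \forall y \near z, (c%:E <= G y)%E) ->
  x <= b ->
  ((f b - f x)%:E <= \int[mu]_(z in `[x, b]) G z)%E.
Proof.
move=> mG G0 H xb.
have step z y : x <= z -> z <= y ->
   ((f z - f x)%:E <= \int[mu]_(t in `[x, z]) G t)%E ->
   ((f y - f z)%:E <= \int[mu]_(t in `]z, y]) G t)%E ->
   ((f y - f x)%:E <= \int[mu]_(t in `[x, y]) G t)%E.
  move=> xz zy h1 h2.
  rewrite (@itv_bndbnd_setU _ _ _ (BRight z))//.
  rewrite ge0_integral_setU//=; last 2 first.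
  - exact: measurable_funS mG.
  - apply/disj_setPS => t /= [] /=; rewrite !in_itv/= => /andP[_ h3] /andP[h4 _].
    by have := lt_le_trans h4 h3; rewrite ltxx.
  by apply: le_trans (leeD h1 h2); rewrite -EFinD lee_fin; lra.
have cint z y c : z <= y -> f y - f z <= c * (y - z) ->
   (forall t, z < t <= y -> (c%:E <= G t)%E) ->
   ((f y - f z)%:E <= \int[mu]_(t in `]z, y]) G t)%E.
  move=> zy h1 h2.
  have [c0|c0] := leP 0 c; last first.
    apply: le_trans (integral_ge0 _ _) => //.
    rewrite lee_fin (le_trans h1)// mulr_le0_ge0 ?subr_ge0// ltW//.
  apply: (@le_trans _ _ (\int[mu]_(t in `]z, y]) (c%:E)))%E.
    rewrite integral_cst//= lebesgue_measure_itv/= lte_fin.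
    move: zy; rewrite le_eqVlt => /predU1P[->|zy].
      by rewrite ltxx subrr mule0.
    by rewrite zy -EFinB -EFinM lee_fin.
  apply: ge0_le_integral => //=.
  exact: measurable_funS mG.
have loc z : x <= z <= b -> exists2 e : R, 0 < e &
    forall x' y', z - e < x' -> y' < z + e ->
    x' <= z <= y' -> (x' == z) || (y' == z) ->
   ((f y' - f x')%:E <= \int[mu]_(t in `]x', y']) G t)%E.
  move=> /H[c [fc fd] [e2 /= e20 h2]].
  have [e1 e10 h1] := derivable_increment_le fd fc.
  exists (Num.min e1 e2); first by rewrite lt_min e10.
  move=> x' y' xe ye /andP[xz zy] xy.
  have m1 : Num.min e1 e2 <= e1 by rewrite ge_min lexx.
  have m2 : Num.min e1 e2 <= e2 by rewrite ge_min lexx orbT.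
  apply: cint (le_trans xz zy) (h1 x' y' _ _ _ xy) _; [lra|lra|by rewrite xz|].
  move=> t tt; apply: h2; rewrite /ball_/= ltr_norml.
  by case/andP: tt => ? ?; apply/andP; split; lra.
(* Real induction on y. *)
pose S := [set y | x <= y <= b /\ ((f y - f x)%:E <= \int[mu]_(z in `[x, y]) G z)%E].
have Sx : S x.
  by split; [rewrite lexx | rewrite subrr integral_ge0].
have hS : has_sup S by split; [exists x | exists b => y [/andP[]]].
have xs : x <= sup S by exact: (sup_upper_bound hS).
have sb : sup S <= b by apply: sup_le_ub => [|y [/andP[]]//]; exists x.
have Ss : S (sup S).
  have [e e0 h] := loc (sup S) ltac:(by rewrite xs sb).
  have [y Sy ys] := sup_adherent e0 hS.
  have yle : y <= sup S by exact: (sup_upper_bound hS).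
  split; first by rewrite xs sb.
  case: Sy => /andP[xy yb] fy.
  apply: (step y) => //; apply: h; rewrite ?yle ?lexx ?eqxx ?orbT//; lra.
have [e e0 h] := loc (sup S) ltac:(by rewrite xs sb).
have [->|nb] := eqVneq b (sup S); first by case: Ss.
have {}sb : sup S < b by rewrite lt_neqAle sb eq_sym nb.
pose y := Num.min b (sup S + e / 2).
have sy : sup S < y by rewrite lt_min sb; lra.
suff Sy : S y by have := sup_upper_bound hS Sy; rewrite leNgt sy.
have yb : y <= b by rewrite ge_min lexx.
have ye : y <= sup S + e / 2 by rewrite ge_min lexx orbT.
split; first by rewrite yb andbT (le_trans xs)// ltW.
case: Ss => _ fs; apply: step xs (ltW sy) fs _.
by apply: h; rewrite ?lexx ?eqxx//= ?ltW//; lra.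
Qed.

(** Vitali-Caratheodory: cut the range of g into slices of height e, enclose each slice
    { i e <= g < (i + 1) e } in an open set of almost the same measure, and add up (i + 1) e over
    these open sets.  The sum G is lower semicontinuous, exceeds g everywhere, and its integral
    exceeds that of g by an arbitrarily small amount. *)
Lemma increment_le_integral_ge0 f g a b x y : a < x -> x <= y -> y < b ->
  measurable_fun `]a, b[ g -> (forall z, a < z < b -> 0 <= g z) ->
  (forall z, a < z < b -> derivable f z 1 /\ f^`()%classic z <= g z) ->
  ((f y - f x)%:E <= \int[mu]_(z in `]a, b[) (g z)%:E)%E.
Proof.
move=> ax xy yb mg g0 dfg.
have ab : a < b by lra.
apply/lee_addgt0Pr => e0 e0_gt0.
(* Rounding g up to the next multiple of e costs e (b - a), the open covers cost e. *)
pose e := e0 / (b - a + 1).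
have e_gt0 : 0 < e by rewrite divr_gt0//; lra.
pose I := `]a, b[%classic : set R.
have muI : mu I = (b - a)%:E by rewrite /I lebesgue_measure_itv/= lte_fin ab.
pose E (i : nat) := I `&` g @^-1` `[i%:R * e, i.+1%:R * e[.
have mE i : measurable (E i) by apply: mg.
have muE i : (mu (E i) < +oo)%E.
  apply: (@le_lt_trans _ _ (mu I)).
    by apply: le_measure; rewrite ?inE /=; [exact: mE|exact: measurable_itv|exact: subIsetl].
  by rewrite /I lebesgue_measure_itv/= lte_fin ab -EFinB ltry.
(* The slack allowed on the i-th slice: weighted by (i + 1) e it is e / 2^(i+1), and these sum
   to e. *)
have d_gt0 (i : nat) : 0 < e / (2 ^ i.+1)%:R / (i.+1%:R * e).
  apply: divr_gt0; last by rewrite mulr_gt0.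
  by apply: divr_gt0 => //; rewrite ltr0n expn_gt0.
have /choice[U HU] (i : nat) := lebesgue_regularity_outer (mE i) (muE i) (d_gt0 i).
have mU i : measurable (U i) by case: (HU i) => oU _ _; exact: open_measurable.
have muU i : ((i.+1%:R * e)%:E * mu (U i) <=
    \int[mu]_(z in E i) (g z + e)%:E + (e / (2 ^ i.+1)%:R)%:E)%E.
  have [_ EU UE] := HU i.
  have -> : (mu (U i) = mu (E i) + mu (U i `\` E i))%E.
    rewrite -{1}(setDUK EU) measureU//; last exact: setDIK.
    - exact: mE.
    - by apply: measurableD; [exact: mU|exact: mE].
  rewrite ge0_muleDr//; apply: leeD.
    rewrite (_ : _ * mu (E i) = \int[mu]_(z in E i) (i.+1%:R * e)%:E)%E; last first.
      by rewrite integral_cst//; exact: mE.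
    apply: ge0_le_integral => //; first exact: mE.
    - by move=> z _; rewrite lee_fin mulr_ge0// ltW.
    - apply/measurable_EFinP; apply: measurable_funD => //.
      by apply: measurable_funS mg => //; exact: subIsetl.
    - move=> z [_ /=]; rewrite in_itv/= => /andP[h _].
      by rewrite lee_fin -natr1 mulrDl mul1r lerD2r.
  apply: (@le_trans _ _ ((i.+1%:R * e)%:E * (e / (2 ^ i.+1)%:R / (i.+1%:R * e))%:E)%E).
    by apply: lee_wpmul2l; [rewrite lee_fin mulr_ge0// ltW|exact: ltW UE].
  by rewrite -EFinM lee_fin mulrC divfK// gt_eqF// mulr_gt0.
pose G z := (\sum_(0 <= i <oo) (i.+1%:R * e * \1_(U i) z)%:E)%E.
have Gi0 (i : nat) z : (0 <= (i.+1%:R * e * \1_(U i) z)%:E)%E.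
  by rewrite lee_fin; apply: mulr_ge0; [apply: mulr_ge0 => //; exact: ltW|rewrite indicE].
have mGi (i : nat) : measurable_fun [set: R] (fun z => (i.+1%:R * e * \1_(U i) z)%:E).
  by apply/measurable_EFinP; apply: measurable_funM => //; exact: measurable_indic.
have G0 z : (0 <= G z)%E by apply: nneseries_ge0 => i _ _; exact: Gi0.
have mG : measurable_fun [set: R] G.
  by apply: ge0_emeasurable_sum => i *; [exact: Gi0|exact: mGi].
have EI : \bigcup_i E i = I.
  rewrite eqEsubset; split => [z [i _ []]//|z Iz].
  exists (Num.truncn (g z / e)) => //; split => //=; rewrite in_itv/=.
  rewrite -ler_pdivlMr// -ltr_pdivrMr//; apply: truncn_itv.
  by rewrite divr_ge0 ?g0// ltW.
have tE : trivIset [set: nat] E.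
  apply/trivIsetP => i j _ _ ij; apply/seteqP; split => // z [[Iz /=]].
  rewrite in_itv/= -ler_pdivlMr// -ltr_pdivrMr// => /truncn_def h1 [_ /=].
  rewrite in_itv/= -ler_pdivlMr// -ltr_pdivrMr// => /truncn_def h2.
  by move: ij; rewrite -h1 -h2 eqxx.
have intG : (\int[mu]_z G z <= \int[mu]_(z in I) (g z)%:E + e0%:E)%E.
  rewrite integral_nneseries//.
  apply: (@le_trans _ _ (\sum_(0 <= i <oo)
     (\int[mu]_(z in E i) (g z + e)%:E + (e / (2 ^ i.+1)%:R)%:E))%E).
    apply: lee_nneseries => [i _ _|i _]; first by apply: integral_ge0.
    apply: le_trans (muU i).
    under eq_integral do rewrite EFinM.
    rewrite ge0_integralZl_EFin//.
    - by rewrite integral_indic ?setIT//; exact: mU.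
    - by apply/measurable_EFinP; apply: measurable_indic; exact: mU.
    - by rewrite mulr_ge0// ltW.
  apply: le_trans (epsilon_trick _ _ (ltW e_gt0)) _ => [i|].
    apply: integral_ge0 => z [/= zI _]; rewrite lee_fin addr_ge0 ?(ltW e_gt0)//.
    by apply: g0; move: zI; rewrite /I/= in_itv.
  have Ige0 z : I z -> 0 <= g z by rewrite /I/= in_itv; exact: g0.
  rewrite -ge0_integral_bigcup//; last 2 first.
  - by rewrite EI; apply/measurable_EFinP; apply: measurable_funD.
  - by rewrite EI => z /Ige0 gz; rewrite lee_fin addr_ge0// ltW.
  rewrite EI; under eq_integral do rewrite EFinD.
  rewrite ge0_integralD//; last 3 first.
  - exact: measurable_itv.
  - by apply/measurable_EFinP.
  - by move=> z _; rewrite lee_fin ltW.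
  rewrite -addeA leeD2l// integral_cst; last exact: measurable_itv.
  rewrite [X in (_ * X)%E](_ : _ = (b - a)%:E); last exact: muI.
  rewrite -EFinM -EFinD lee_fin /e -{2}(mulr1 (e0 / _)) -mulrDr divfK//.
  by rewrite gt_eqF//; lra.
apply: le_trans intG.
apply: (@le_trans _ _ (\int[mu]_(z in `[x, y]) G z)%E); last first.
  by apply: ge0_subset_integral.
apply: increment_le_integral => // z /andP[xz zy].
have zI : a < z < b by apply/andP; split; lra.
have [df fg] := dfg z zI.
have [i _ [_ /= gi]] : (\bigcup_i E i) z by rewrite EI /I/= in_itv.
exists (i.+1%:R * e).
  by split => //; apply: le_lt_trans fg _; move: gi; rewrite in_itv/= => /andP[].
have [oU EU _] := HU i.
have nU : nbhs z (U i) by apply: open_nbhs_nbhs; split => //; apply: EU; split => //=; rewrite /I/= in_itv.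
near=> t.
have Ut : U i t by near: t.
rewrite /G.
apply: le_trans (@nneseries_lim_ge _ _ xpredT 0 i.+1 _) => [|*]; last exact: Gi0.
rewrite big_nat_recr//=.
rewrite indicE mem_set// mulr1 leeDr// sume_ge0// => j _; exact: Gi0.
Unshelve. all: by end_near. Qed.

(** Replacing g by max(g, -n) + n and f x by f x + n x reduces to a non-negative g; the
    one-sided limits move the end points to a and b, and dominated convergence removes n. *)
Lemma increment_le_integral_oo f g a b (la lb : R) : a < b ->
  mu.-integrable `]a, b[ (EFin \o g) ->
  (forall z, a < z < b -> derivable f z 1 /\ f^`()%classic z <= g z) ->
  f x @[x --> a^'+] --> la -> f x @[x --> b^'-] --> lb ->
  lb - la <= \int[mu]_(z in `]a, b[) g z.
Proof.
move=> ab ig dfg fa fb.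
have mg : measurable_fun `]a, b[ g by apply/measurable_EFinP; exact: measurable_int ig.
have main (n : nat) : ((lb - la)%:E <= \int[mu]_(z in `]a, b[) (Num.max (g z) (- n%:R))%:E)%E.
  (* Non-negative, and at least the derivative of fn. *)
  pose gn z := Num.max (g z) (- n%:R) + n%:R.
  pose fn z := f z + n%:R * z.
  have mgn : measurable_fun `]a, b[ gn.
    by apply: measurable_funD => //; apply: measurable_maxr.
  have ign : mu.-integrable `]a, b[ (fun z => (Num.max (g z) (- n%:R))%:E).
    apply: (@le_integrable _ _ _ mu _ _ _ (fun z => `|(g z)%:E|%E)) => //.
    - by apply/measurable_EFinP; apply: measurable_maxr.
    - move=> z _ /=; rewrite lee_fin normr_id.
      have [h1|h1] := leP (g z) (- n%:R) => //.
      have n0 : (0 : R) <= n%:R by [].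
      by rewrite ler0_norm ?oppr_le0// ler0_norm; lra.
    - exact: integrable_abse.
  have lebn : mu `]a, b[%classic = (b - a)%:E.
    by rewrite lebesgue_measure_itv/= lte_fin ab.
  have icn : mu.-integrable `]a, b[ (fun=> n%:R%:E).
    apply/integrableP; split; first exact: measurable_cst.
    under eq_integral do rewrite abse_EFin.
    by rewrite integral_cst//= lebn -EFinM ltry.
  have dfn z : a < z < b -> is_derive z 1 fn (f^`()%classic z + n%:R).
    move=> /dfg[df _]; rewrite /fn derive1E.
    have df' := derivableP df.
    by apply: is_derive_eq; rewrite -[n%:R *: _]/(n%:R * _) mulr1.
  have fnE : (\int[mu]_(z in `]a, b[) (gn z)%:E =
     \int[mu]_(z in `]a, b[) (Num.max (g z) (- n%:R))%:E + (n%:R * (b - a))%:E)%E.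
    under eq_integral do rewrite EFinD.
    rewrite integralD//; congr (_ + _)%E.
    by rewrite integral_cst ?EFinM -?lebn//; exact: measurable_itv.
  rewrite -(@leeD2rE _ (n%:R * (b - a))%:E)// -fnE.
  rewrite -EFinD.
  have bnd x y : a < x -> x <= y -> y < b ->
     ((fn y - fn x)%:E <= \int[mu]_(z in `]a, b[) (gn z)%:E)%E.
    move=> ax xy yb; apply: increment_le_integral_ge0 => //.
      by move=> z _; rewrite /gn; have := leP (g z) (- n%:R) => -[]; lra.
    move=> z zab; have dz := dfn z zab.
    split; first exact: ex_derive.
    rewrite derive1E (@derive_val _ _ _ _ _ _ _ dz) lerD2r le_max.
    by case: (dfg z zab) => _ ->.
  have ifin : (\int[mu]_(z in `]a, b[) (gn z)%:E)%E \is a fin_num.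
    by rewrite fnE fin_numD andbT; apply: integrable_fin_num => //; exact: measurable_itv.
  move: ifin bnd; case: (\int[mu]_(z in _) _)%E => // I _ bnd.
  rewrite lee_fin.
  pose m := (a + b) / 2.
  have fnb : fn x @[x --> b^'-] --> lb + n%:R * b.
    apply: cvgD => //; apply: cvgM; first exact: cvg_cst.
    exact: cvg_at_left_filter.
  have fna : fn x @[x --> a^'+] --> la + n%:R * a.
    apply: cvgD => //; apply: cvgM; first exact: cvg_cst.
    exact: cvg_at_right_filter.
  have h1 x : a < x -> x < b -> lb + n%:R * b - fn x <= I.
    move=> ax xb; rewrite lerBlDr.
    apply: (cvgr_to_le fnb); near=> y.
    rewrite -lerBlDr -lee_fin; apply: bnd => //; near: y.
    exact: nbhs_left_ge.
  suff : lb + n%:R * b - I <= la + n%:R * a by lra.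
  apply: (cvgr_to_ge fna); near=> x.
  have : lb + n%:R * b - fn x <= I.
    by apply: h1; near: x; [exact: nbhs_right_gt|exact: nbhs_right_lt].
  lra.
have [| | | | |_ _ cv] := @dominated_convergence _ _ _ mu `]a, b[%classic (measurable_itv _)
   (fun n z => (Num.max (g z) (- n%:R))%:E) (EFin \o g) (fun z => `|(g z)%:E|%E).
- by move=> n; apply/measurable_EFinP; apply: measurable_maxr.
- by apply/measurable_EFinP.
- apply: aeW => z _; apply: cvg_near_cst; near=> n; congr EFin; apply/max_idPl.
  by rewrite lerNl; near: n; exact: nbhs_infty_ger.
- exact: integrable_abse.
- apply: aeW => z n _ /=; rewrite lee_fin.
  have [h1|h1] := leP (g z) (- n%:R) => //.
  have n0 : (0 : R) <= n%:R by [].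
  by rewrite ler0_norm ?oppr_le0// ler0_norm; lra.
rewrite -lee_fin /Rintegral fineK; last first.
  by apply: integrable_fin_num => //; exact: measurable_itv.
apply: (cvge_to_ge cv) ; near=> n; exact: main.
Unshelve. all: by end_near. Qed.

(** The previous inequality for f and for -f.  This form of the fundamental theorem asks for
    integrability of f' but not for its continuity, which is what is known of the state
    probabilities. *)
Lemma integral_derive1 f a b (la lb : R) : a < b ->
  mu.-integrable `]a, b[ (EFin \o f^`()%classic) ->
  (forall z, a < z < b -> derivable f z 1) ->
  f x @[x --> a^'+] --> la -> f x @[x --> b^'-] --> lb ->
  \int[mu]_(z in `]a, b[) f^`()%classic z = lb - la.
Proof.
move=> ab ig df fa fb; apply/eqP; rewrite eq_le; apply/andP; split; last first.
  by apply: (increment_le_integral_oo (f := f)) => // z /df.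
suff : - lb - - la <= \int[mu]_(z in `]a, b[) (- 1 * f^`()%classic z).
  by rewrite RintegralZl//; lra.
apply: (increment_le_integral_oo (f := \- f)) => //.
- have := integrableZl _ (- 1)%R ig => /(_ (measurable_itv _)).
  by apply: eq_integrable => // z _ /=; rewrite EFinM.
- move=> z /df dz; split; first exact: derivableN.
  by rewrite !derive1E deriveN// mulN1r.
- exact: cvgN.
- exact: cvgN.
Qed.

End DerivativeIntegral.

(** * Power kernels and the Gamma function *)

Section AffineChange.
Context {R : realType}.
Local Notation mu := (@lebesgue_measure R).
Local Open Scope ereal_scope.

Lemma ge0_integral_shift (f : R -> \bar R) (c : R) :
  measurable_fun [set: R] f -> (forall x, 0 <= f x) ->
  \int[mu]_x f (x + c)%R = \int[mu]_x f x.
Proof.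
move=> mf f0.
have mphi : measurable_fun [set: measurableTypeR R] (fun x : measurableTypeR R => (x + c)%R : measurableTypeR R).
  by apply: measurable_funD.
transitivity (\int[pushforward mu (fun x : measurableTypeR R => (x + c)%R : measurableTypeR R)]_x f x).
  by rewrite ge0_integral_pushforward.
apply: eq_measure_integral => A mA _; apply/esym/lebesgue_measure_unique => //.
move=> _ [[a b]] _ <-.
change (mu `]a, b] = mu ((fun x : R => (x + c)%R) @^-1` `]a, b])).
rewrite (_ : _ @^-1` _ = `](a - c)%R, (b - c)%R]%classic).
  rewrite !lebesgue_measure_itv/= !lte_fin ltrD2r; case: ifP => // _.
  by rewrite -!EFinB; congr EFin; lra.
by apply/seteqP; split => x /=; rewrite !in_itv/=; lra.
Qed.

Lemma ge0_integral_scale (f : R -> \bar R) (c : R) : (0 < c)%R ->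
  measurable_fun [set: R] f -> (forall x, 0 <= f x) ->
  c%:E * \int[mu]_x f (c * x)%R = \int[mu]_x f x.
Proof.
move=> c0 mf f0.
have mphi : measurable_fun [set: measurableTypeR R] (fun x : measurableTypeR R => (c * x)%R : measurableTypeR R).
  by apply: measurable_funM.
transitivity (c%:E * \int[pushforward mu (fun x : measurableTypeR R => (c * x)%R : measurableTypeR R)]_x f x).
  by rewrite ge0_integral_pushforward.
have cn0 : (0 <= c)%R by rewrite ltW.
rewrite -(@ge0_integral_mscale _ _ _ _ _ _ (NngNum cn0))//.
apply: eq_measure_integral => A mA _; apply/esym/lebesgue_measure_unique => //.
move=> _ [[a b]] _ <-; rewrite /mscale/=.
change (mu `]a, b] = c%:E * mu ((fun x : R => (c * x)%R) @^-1` `]a, b])).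
rewrite (_ : _ @^-1` _ = `](a / c)%R, (b / c)%R]%classic).
  rewrite !lebesgue_measure_itv/= !lte_fin ltr_pM2r ?invr_gt0//; case: ifP => // _; last by rewrite mule0.
  by rewrite -!EFinB -EFinM; congr EFin; rewrite mulrBr mulrCA divff ?gt_eqF// mulrCA divff ?gt_eqF//; lra.
by apply/seteqP; split => x /=; rewrite !in_itv/= ltr_pdivrMr// ler_pdivlMr// mulrC.
Qed.

End AffineChange.

Section Kernel.
Context {R : realType}.
Local Notation mu := (@lebesgue_measure R).
Implicit Types a b x v : R.

(** Extended by 0 to the whole line, so that fractional integrals are convolutions and Tonelli
    applies without bookkeeping of domains. *)
Definition frac_kernel a x : R := ((@powR R ^~ (a - 1)) \_ `]0, +oo[) x.

Lemma frac_kernelE a x : frac_kernel a x = if 0 < x then x `^ (a - 1) else 0.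
Proof. by rewrite /frac_kernel patchE mem_setE in_itv/= andbT. Qed.

Lemma measurable_frac_kernel a : measurable_fun [set: R] (frac_kernel a).
Proof.
apply/(@measurable_restrict _ _ _ _ _ setT); rewrite ?setTI//.
exact: measurable_funTS.
Qed.

Lemma frac_kernel_ge0 a x : 0 <= frac_kernel a x.
Proof. by rewrite frac_kernelE; case: ifP => // _; exact: powR_ge0. Qed.

(** The value at v of the convolution of two power kernels; at v = 1, the Beta function. *)
Definition beta_conv a b v : \bar R := (\int[mu]_x (frac_kernel a x * frac_kernel b (v - x))%:E)%E.
(** Euler's integral with values in [0, +oo], usable before its finiteness is known; its real
    value is Gamma by [GammaE]. *)
Definition eGamma a : \bar R := (\int[mu]_x (frac_kernel a x * expR (- x))%:E)%E.

Lemma measurable_frac_kernelB a v : measurable_fun [set: R] (fun x => frac_kernel a (v - x)).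
Proof.
apply: (measurableT_comp (measurable_frac_kernel a)).
exact: measurable_funB.
Qed.

Lemma measurable_frac_kernelM a b v : measurable_fun [set: R] (fun x => frac_kernel a x * frac_kernel b (v - x)).
Proof. by apply: measurable_funM; [exact: measurable_frac_kernel|exact: measurable_frac_kernelB]. Qed.

Lemma beta_conv_ge0 a b v : (0 <= beta_conv a b v)%E.
Proof. by apply: integral_ge0 => x _; rewrite lee_fin mulr_ge0// frac_kernel_ge0. Qed.

Lemma frac_kernelM a v x : 0 < v -> frac_kernel a (v * x) = v `^ (a - 1) * frac_kernel a x.
Proof.
move=> v0; rewrite !frac_kernelE pmulr_rgt0//; case: ifPn => [x0|]; last by rewrite mulr0.
by rewrite powRM// ltW.
Qed.

(** The substitution x = v y, by homogeneity of the kernels. *)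
Lemma beta_convE a b v : beta_conv a b v = ((frac_kernel (a + b) v)%:E * beta_conv a b 1)%E.
Proof.
have [v0|v0] := ltP 0 v; last first.
  rewrite [in RHS]frac_kernelE ltNge v0/= mul0e /beta_conv.
  rewrite (eq_integral (fun=> 0%E)) ?integral0// => x _.
  rewrite !frac_kernelE; case: ifPn; rewrite ?mul0r// => x0.
  by rewrite ifF ?mulr0//; apply/negbTE; rewrite -leNgt subr_le0 (le_trans v0)// ltW.
have h : measurable_fun [set: R] (fun x => (frac_kernel a x * frac_kernel b (v - x))%:E).
  by apply/measurable_EFinP; exact: measurable_frac_kernelM.
have h0 x : (0 <= (frac_kernel a x * frac_kernel b (v - x))%:E)%E by rewrite lee_fin mulr_ge0// frac_kernel_ge0.
transitivity (v%:E * \int[mu]_x (frac_kernel a (v * x) * frac_kernel b (v - v * x))%:E)%E.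
  exact: esym (ge0_integral_scale v0 h h0).
under eq_integral => x _.
  rewrite (_ : v - v * x = v * (1 - x)); last by ring.
  rewrite !frac_kernelM// mulrACA EFinM; over.
rewrite ge0_integralZl_EFin//.
- rewrite muleA -EFinM; congr (_%:E * _)%E.
  rewrite frac_kernelE v0 -powRD; last by rewrite (gt_eqF v0) implybT.
  rewrite -{1}(powRr1 (ltW v0)) -powRD; last by rewrite (gt_eqF v0) implybT.
  by congr powR; ring.
- by move=> x _; rewrite lee_fin mulr_ge0// frac_kernel_ge0.
- by apply/measurable_EFinP; exact: measurable_frac_kernelM.
- by rewrite mulr_ge0// powR_ge0.
Qed.

Lemma eGamma_ge0 a : (0 <= eGamma a)%E.
Proof. by apply: integral_ge0 => x _; rewrite lee_fin mulr_ge0// ?frac_kernel_ge0// expR_ge0. Qed.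

Lemma measurable_frac_kernel_exp a : measurable_fun [set: R] (fun x => frac_kernel a x * expR (- x)).
Proof.
apply: measurable_funM; first exact: measurable_frac_kernel.
by apply: measurableT_comp => //; exact: measurable_expR.
Qed.

(** Tonelli on the product of two Euler integrals, after the shift y -> y + x: the relation
    between the Beta and Gamma functions. *)
Lemma eGamma_conv a b : (eGamma a * eGamma b = beta_conv a b 1 * eGamma (a + b))%E.
Proof.
pose F (z : R * R) := (frac_kernel a z.1 * frac_kernel b (z.2 - z.1) * expR (- z.2))%:E.
have mF : measurable_fun [set: R * R] F.
  apply/measurable_EFinP; apply: measurable_funM; first apply: measurable_funM.
  - by apply: (measurableT_comp (measurable_frac_kernel a)).
  - by apply: (measurableT_comp (measurable_frac_kernel b)); apply: measurable_funB.
  - by apply: (measurableT_comp (@measurable_expR _)); apply: measurableT_comp.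
have F0 z : (0 <= F z)%E.
  by rewrite lee_fin !mulr_ge0 ?frac_kernel_ge0 ?expR_ge0.
transitivity (\int[mu]_x \int[mu]_y F (x, y))%E.
  transitivity (\int[mu]_x ((frac_kernel a x * expR (- x))%:E * eGamma b))%E.
    rewrite ge0_integralZr//.
    - by apply/measurable_EFinP; exact: measurable_frac_kernel_exp.
    - by move=> x _; rewrite lee_fin mulr_ge0 ?frac_kernel_ge0 ?expR_ge0.
    - exact: eGamma_ge0.
  apply: eq_integral => x _.
  rewrite -[in RHS](ge0_integral_shift (f := fun y => F (x, y)) x)//; last first.
    exact: measurable_fun_pair2 mF.
  rewrite /eGamma -ge0_integralZl_EFin//.
  - by apply: eq_integral => y _; rewrite /F/= addrK opprD expRD -EFinM; congr EFin; ring.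
  - by move=> y _; rewrite lee_fin mulr_ge0 ?frac_kernel_ge0 ?expR_ge0.
  - by apply/measurable_EFinP; exact: measurable_frac_kernel_exp.
  - by rewrite mulr_ge0 ?frac_kernel_ge0 ?expR_ge0.
transitivity (\int[mu]_y \int[mu]_x F (x, y))%E.
  exact: (fubini_tonelli (m1 := mu) (m2 := mu) F mF F0).
transitivity (\int[mu]_y ((frac_kernel (a + b) y * expR (- y))%:E * beta_conv a b 1))%E.
  apply: eq_integral => y _.
  transitivity ((expR (- y))%:E * beta_conv a b y)%E.
    rewrite /beta_conv -ge0_integralZl_EFin//.
    - by apply: eq_integral => x _; rewrite /F/= -EFinM mulrC.
    - by move=> x _; rewrite lee_fin mulr_ge0 ?frac_kernel_ge0.
    - by apply/measurable_EFinP; exact: measurable_frac_kernelM.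
  by rewrite beta_convE muleA -EFinM mulrC.
rewrite ge0_integralZr//.
- by rewrite muleC.
- by apply/measurable_EFinP; exact: measurable_frac_kernel_exp.
- by move=> x _; rewrite lee_fin mulr_ge0 ?frac_kernel_ge0 ?expR_ge0.
- exact: beta_conv_ge0.
Qed.

Lemma frac_kernel_exp_ge0 a x : 0 <= frac_kernel a x * expR (- x).
Proof. by rewrite mulr_ge0 ?frac_kernel_ge0 ?expR_ge0. Qed.

(** The fundamental theorem on [1/(i+1), 1], and monotone convergence towards the
    singularity at 0. *)
Lemma ge0_integral_powR01 a : 0 < a ->
  (\int[mu]_(x in `]0%R, 1%R]) (x `^ (a - 1))%:E = a^-1%:E)%E.
Proof.
move=> a0.
pose u (i : nat) : R := 0 + i.+1%:R^-1.
have u_gt0 i : 0 < u i by rewrite /u add0r invr_gt0.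
have dF x : 0 < x -> is_derive x 1 (fun y => y `^ a / a) (x `^ (a - 1)).
  move=> x0; have d := is_derive1_powR a x0.
  apply: is_derive_eq.
  by rewrite scaler0 add0r -[_ *: _]/(_ * _) mulrA mulVf ?mul1r// gt_eqF.
have dP x : 0 < x -> derivable (fun y => y `^ (a - 1)) x 1.
  by move=> x0; apply: derivable_powR; rewrite in_itv/= x0.
have cF x : 0 < x -> {for x, continuous (fun y => y `^ a / a)}.
  move=> x0; apply: differentiable_continuous; apply/derivable1_diffP.
  by have [] := dF _ x0.
have intE i : (\int[mu]_(x in `[u i.+1, 1%R]) (x `^ (a - 1))%:E = ((1 - u i.+1 `^ a) / a)%:E)%E.
  have ui1 : u i.+1 < 1 by rewrite /u add0r invf_lt1// ltr1n.
  rewrite (continuous_FTC2 (F := fun y => y `^ a / a) ui1).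
  - by rewrite powR1 -EFinB; congr EFin; ring.
  - apply: derivable_within_continuous => x; rewrite in_itv/= => /andP[ux _].
    by apply: dP; exact: lt_le_trans ux.
  - split.
    + move=> x; rewrite in_itv/= => /andP[ux _].
      by have [] := dF x (lt_trans (u_gt0 _) ux).
    + by apply: cvg_at_right_filter; exact: cF.
    + by apply: cvg_at_left_filter; exact: cF.
  - move=> x; rewrite in_itv/= => /andP[ux _].
    have d := dF x (lt_trans (u_gt0 _) ux).
    by rewrite derive1E derive_val.
rewrite itv_open_bnd_bigcup.
have cv : (\int[mu]_(x in `[u i, 1%R]) (x `^ (a - 1))%:E @[i --> \oo] -->
    \int[mu]_(x in \bigcup_i `[u i, 1%R]%classic) (x `^ (a - 1))%:E)%E.
  apply: ge0_nondecreasing_set_cvg_integral => //.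
  - move=> n m nm; apply/subsetPset => x /=; rewrite !in_itv/= => /andP[h ->].
    rewrite andbT (le_trans _ h)// /u !add0r lef_pV2 ?posrE//.
    by rewrite ler_nat.
  - by move=> i; apply/measurable_EFinP; apply: measurable_funTS.
  - by move=> i x _; rewrite lee_fin powR_ge0.
rewrite -[LHS](cvg_lim _ cv)//; apply/cvg_lim => //.
rewrite -cvg_shiftS /=.
under eq_fun do rewrite intE.
apply: cvg_EFin; first by apply: nearW.
rewrite -[X in _ --> X](_ : (1 - 0) / a = _); last by rewrite subr0 mul1r.
apply: cvgMr_tmp; apply: cvgB; first exact: cvg_cst.
have := powR_cvg0 a0; move/cvg_at_rightP; apply; split => [i|]; first exact: u_gt0.
rewrite (_ : (fun _ => _) = fun n => (harmonic n.+1 : R)); last first.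
  by apply/funext => n; rewrite /u add0r.
have := @cvg_harmonic R; by rewrite -cvg_shiftS.
Qed.

Lemma beta_conv1 a : 0 < a -> beta_conv a 1 1 = (a^-1)%:E.
Proof.
move=> a0; rewrite -ge0_integral_powR01// /beta_conv.
rewrite -integral_itv_bndo_bndc; last first.
  by apply/measurable_EFinP; apply: measurable_funTS.
rewrite [RHS]integral_mkcond; apply: eq_integral => x _.
rewrite patchE mem_setE in_itv/= !frac_kernelE subr_gt0.
by case: ifPn; case: ifPn; rewrite ?mul0r ?mulr0// subrr powRr0 mulr1.
Qed.

Lemma eGamma1 : eGamma 1 = 1%E.
Proof.
rewrite -(@integral_exponential_pdf R 1 ltr01).
transitivity (\int[mu]_(x in `]0%R, +oo[) (expR (- x))%:E)%E.
  rewrite /eGamma [RHS]integral_mkcond; apply: eq_integral => x _.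
  rewrite patchE mem_setE in_itv/= andbT frac_kernelE.
  by case: ifP => _; rewrite ?mul0r// subrr powRr0 mul1r.
rewrite integral_itv_obnd_cbnd; last first.
  apply/measurable_EFinP; apply: measurable_funTS.
  by apply: measurableT_comp => //; exact: measurable_expR.
rewrite [LHS]integral_mkcond; apply: eq_integral => x _.
by rewrite /exponential_pdf !patchE; case: ifP => _ //; rewrite mul1r mulN1r.
Qed.

(** The relation with the Beta function for b = 1, where B(a, 1) = 1 / a. *)
Lemma eGammaS a : 0 < a -> eGamma (a + 1) = (a%:E * eGamma a)%E.
Proof.
move=> a0; have := eGamma_conv a 1; rewrite eGamma1 mule1 beta_conv1// => ->.
by rewrite muleA -EFinM divff ?mul1e// gt_eqF.
Qed.

Lemma eGamma_fact n : eGamma (n.+1%:R) = (n`!%:R)%:E.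
Proof.
elim: n => [|n ih]; first exact: eGamma1.
by rewrite -natr1 eGammaS// ih -EFinM -natrM.
Qed.

(** Pointwise x^a <= x^q + x^(q+1), by the cases x <= 1 and x > 1; the right-hand side
    integrates to q! + (q+1)!. *)
Lemma eGamma_le_itv (q : nat) a : q%:R <= a <= q.+1%:R ->
  (eGamma (a + 1) <= (q`!%:R * (q.+2)%:R)%:E)%E.
Proof.
move=> /andP[qa aq].
have -> : ((q`!%:R * (q.+2)%:R)%:E = eGamma (q.+1%:R) + eGamma (q.+2%:R))%E.
  rewrite !eGamma_fact -EFinD; congr EFin.
  by rewrite factS natrM -(natr1 q.+1); ring.
rewrite /eGamma -ge0_integralD//.
- apply: ge0_le_integral => //.
  + by move=> x _; rewrite lee_fin frac_kernel_exp_ge0.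
  + by apply/measurable_EFinP; exact: measurable_frac_kernel_exp.
  + apply/measurable_EFinP; apply: measurable_funD; exact: measurable_frac_kernel_exp.
  + move=> x _; rewrite -EFinD lee_fin -mulrDl ler_wpM2r ?expR_ge0//.
    rewrite !frac_kernelE; case: ifPn => [x0|]; last by rewrite addr0.
    have [x1|x1] := leP x 1.
      rewrite ler_wpDr ?powR_ge0//; apply: ger_powR; rewrite ?x0 ?x1//.
      by rewrite -natr1; lra.
    rewrite ler_wpDl ?powR_ge0//; apply: ler_powR; first exact: ltW.
    by rewrite -(natr1 q.+1); lra.
- by move=> x _; rewrite lee_fin frac_kernel_exp_ge0.
- by apply/measurable_EFinP; exact: measurable_frac_kernel_exp.
- by move=> x _; rewrite lee_fin frac_kernel_exp_ge0.
- by apply/measurable_EFinP; exact: measurable_frac_kernel_exp.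
Qed.

(** Only the part x > v of Euler's integral is kept, where x^a >= v^a. *)
Lemma eGamma_ge a v : 0 <= a -> 0 <= v -> ((v `^ a * expR (- v))%:E <= eGamma (a + 1))%E.
Proof.
move=> a0 v0.
have -> : ((v `^ a * expR (- v))%:E = \int[mu]_x (v `^ a * (frac_kernel 1 (x - v) * expR (- x)))%:E)%E.
  pose f x : \bar R := (v `^ a * (frac_kernel 1 (x - v) * expR (- x)))%:E.
  rewrite -[RHS](@ge0_integral_shift _ f v)/f//; last 2 first.
  - apply/measurable_EFinP; apply: measurable_funM => //; apply: measurable_funM.
      by apply: (measurableT_comp (measurable_frac_kernel 1)); exact: measurable_funB.
    by apply: measurableT_comp => //; exact: measurable_expR.
  - by move=> x; rewrite lee_fin !mulr_ge0 ?powR_ge0 ?frac_kernel_ge0 ?expR_ge0.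
  transitivity (\int[mu]_x ((v `^ a * expR (- v))%:E * (frac_kernel 1 x * expR (- x))%:E))%E; last first.
    by apply: eq_integral => x _; rewrite addrK opprD expRD -EFinM; congr EFin; ring.
  rewrite ge0_integralZl_EFin//.
  - by rewrite -/(eGamma 1) eGamma1 mule1.
  - by move=> x _; rewrite lee_fin frac_kernel_exp_ge0.
  - by apply/measurable_EFinP; exact: measurable_frac_kernel_exp.
  - by rewrite mulr_ge0 ?powR_ge0 ?expR_ge0.
apply: ge0_le_integral => //.
- by move=> x _; rewrite lee_fin !mulr_ge0 ?powR_ge0 ?frac_kernel_ge0 ?expR_ge0.
- apply/measurable_EFinP; apply: measurable_funM => //; apply: measurable_funM.
    by apply: (measurableT_comp (measurable_frac_kernel 1)); exact: measurable_funB.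
  by apply: measurableT_comp => //; exact: measurable_expR.
- by apply/measurable_EFinP; exact: measurable_frac_kernel_exp.
- move=> x _; rewrite lee_fin mulrA ler_wpM2r ?expR_ge0// !frac_kernelE subr_gt0.
  case: ifPn => [vx|_]; last by rewrite mulr0; case: ifP => // _; exact: powR_ge0.
  rewrite (le_lt_trans v0 vx) subrr powRr0 mulr1 addrK.
  by apply: ge0_ler_powR; rewrite ?nnegrE// ?(le_trans v0)// ltW.
Qed.

Lemma GammaE a : Gamma a = fine (eGamma a).
Proof.
rewrite /Gamma /Rintegral integral_mkcond; congr fine; apply: eq_integral => x _.
by rewrite patchE mem_setE in_itv/= andbT frac_kernelE; case: ifP => _; rewrite ?mul0r.
Qed.

(** Away from 0 the integrand is dominated as in [eGamma_le_itv]; the functional equation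
    carries finiteness from a + 1 down to a. *)
Lemma eGamma_fin a : 0 < a -> eGamma a \is a fin_num.
Proof.
move=> a0.
have : eGamma (a + 1) \is a fin_num.
  rewrite ge0_fin_numE ?eGamma_ge0//.
  apply: le_lt_trans (@eGamma_le_itv (Num.truncn a) a _) _; last exact: ltry.
  by have /andP[-> /ltW ->] := truncn_itv (ltW a0).
rewrite eGammaS//; case: (eGamma a) => //.
- by rewrite gt0_muley// lte_fin.
- by rewrite gt0_muleNy// lte_fin.
Qed.

Lemma eGamma_EFin a : 0 < a -> eGamma a = (Gamma a)%:E.
Proof. by move=> a0; rewrite GammaE fineK// eGamma_fin. Qed.

Lemma GammaS a : 0 < a -> Gamma (a + 1) = a * Gamma a.
Proof.
move=> a0; apply: EFin_inj; rewrite EFinM -!eGamma_EFin ?eGammaS//.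
by rewrite addr_gt0.
Qed.

Lemma Gamma1 : Gamma 1 = 1 :> R.
Proof. by rewrite GammaE eGamma1. Qed.

Lemma Gamma_ge a v : 0 <= a -> 0 <= v -> v `^ a * expR (- v) <= Gamma (a + 1).
Proof.
by move=> a0 v0; rewrite -lee_fin -eGamma_EFin ?eGamma_ge//; rewrite ltr_wpDl.
Qed.

Lemma Gamma_gt0 a : 0 < a -> 0 < Gamma a.
Proof.
move=> a0; rewrite -(pmulr_rgt0 _ a0) -GammaS//.
apply: lt_le_trans (Gamma_ge (ltW a0) ler01).
by rewrite mulr_gt0 ?powR_gt0 ?expR_gt0.
Qed.

Lemma Gamma_le_itv (q : nat) a : q%:R <= a <= q.+1%:R ->
  Gamma (a + 1) <= q`!%:R * (q.+2)%:R.
Proof.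
move=> qa; have a0 : 0 <= a by case/andP: qa => [qa _]; rewrite (le_trans _ qa).
by rewrite -lee_fin -eGamma_EFin ?eGamma_le_itv//; rewrite ltr_wpDl.
Qed.

Lemma beta_conv_Gamma a b : 0 < a -> 0 < b ->
  beta_conv a b 1 = (Gamma a * Gamma b / Gamma (a + b))%:E.
Proof.
move=> a0 b0; have ab0 : 0 < a + b by rewrite addr_gt0.
have := eGamma_conv a b; rewrite !eGamma_EFin//.
have := Gamma_gt0 ab0; have := beta_conv_ge0 a b 1.
case: (beta_conv a b 1) => [r| |]// _ g0.
- by rewrite -!EFinM => -[->]; rewrite mulfK// gt_eqF.
- by rewrite gt0_mulye.
Qed.

End Kernel.

(** * The Caputo derivative *)

Section Volterra.
Context {R : realType}.
Local Notation mu := (@lebesgue_measure R).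
Variable alpha : R.
Hypothesis alpha01 : 0 < alpha < 1.
Implicit Types (f : R -> R) (s t : R).

Let a0 : 0 < alpha. Proof. by case/andP: alpha01. Qed.
Let b0 : 0 < 1 - alpha. Proof. by case/andP: alpha01; lra. Qed.

(** The Caputo integrand (t - s)^(-alpha) f' times the bounded factor (t - s)^alpha. *)
Lemma caputo_derivable_integrable f t : 0 < t -> caputo_derivable alpha f ->
  mu.-integrable `]0, t[ (EFin \o f^`()%classic).
Proof.
move=> t0 [_ df /(_ t t0) it].
pose g s := (t - s) `^ alpha * caputo_integrand alpha f t s.
have gE s : 0 < s < t -> g s = f^`()%classic s.
  move=> /andP[s0 st]; rewrite /g /caputo_integrand mulrA -powRD ?subrr ?powRr0 ?mul1r//.
  by rewrite subr_eq0 (gt_eqF st) implybT.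
have mg : measurable_fun `]0, t[ g.
  apply: measurable_funM; last by apply/measurable_EFinP; exact: measurable_int it.
  apply: measurable_funTS; apply: (measurableT_comp (measurable_powR alpha)).
  exact: measurable_funB.
apply: (@eq_integrable _ _ _ mu _ _ (EFin \o g)) => //.
  by move=> s; rewrite inE/= in_itv/= => /gE ->.
apply: (@le_integrable _ _ _ mu _ _ _ (fun s => ((t `^ alpha)%:E * (caputo_integrand alpha f t s)%:E)%E)) => //.
- exact/measurable_EFinP.
- move=> s /=; rewrite in_itv/= => /andP[s0 st].
  rewrite lee_fin !normrM ler_wpM2r// !ger0_norm ?powR_ge0//.
  by apply: ge0_ler_powR; rewrite ?nnegrE ?subr_ge0 ?ltW//; lra.
- exact: integrableZl.
Qed.

Lemma caputo_derivable_cvg_left f t : 0 < t -> caputo_derivable alpha f ->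
  f x @[x --> t^'-] --> f t.
Proof.
move=> t0 [_ df _]; apply: cvg_at_left_filter.
by apply: differentiable_continuous; apply/derivable1_diffP; exact: df.
Qed.

(** Abel inversion.  The left-hand side is a double integral of f' r against the kernels
    (t - s)^(alpha - 1) and (s - r)^(- alpha); integrating first over s gives, by the Beta
    integral with exponents alpha and 1 - alpha, the constant Gamma alpha Gamma (1 - alpha), and
    what remains is the integral of f'. *)
Lemma volterra f t : 0 < t -> caputo_derivable alpha f ->
  (\int[mu]_(s in `]0%R, t[) ((t - s) `^ (alpha - 1) * caputo alpha f s)%:E =
   (Gamma alpha * (f t - f 0))%:E)%E.
Proof.
move=> t0 cf.
have ift := caputo_derivable_integrable t0 cf.
have [f0 df icap] := cf.
have intf : \int[mu]_(s in `]0, t[) f^`()%classic s = f t - f 0.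
  apply: integral_derive1 => //; first by move=> z /andP[z0 _]; exact: df.
  exact: caputo_derivable_cvg_left.
pose phi := (f^`()%classic) \_ `]0, t[.
have phiE r : phi r = if 0 < r < t then f^`()%classic r else 0.
  by rewrite /phi patchE mem_setE in_itv/=.
have iphi : mu.-integrable [set: R] (EFin \o phi).
  move/integrable_mkcond : ift => /(_ (measurable_itv _)).
  by rewrite -restrict_EFin.
have mphi : measurable_fun [set: R] phi by apply/measurable_EFinP; exact: measurable_int iphi.
pose g := Gamma (1 - alpha).
have g0 : 0 < g by exact: Gamma_gt0.
have ga0 : 0 <= Gamma alpha := ltW (Gamma_gt0 a0).
have gV0 : 0 <= g^-1 by rewrite invr_ge0; exact: ltW g0.
(* The kernels vanish unless r < s < t, so that both integrals extend over the line. *)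
pose K (s r : R) := frac_kernel alpha (t - s) * frac_kernel (1 - alpha) (s - r).
have K0 s r : 0 <= K s r by rewrite mulr_ge0 ?frac_kernel_ge0.
have mK : measurable_fun [set: R * R] (fun z => K z.1 z.2).
  apply: measurable_funM.
    by apply: (measurableT_comp (measurable_frac_kernel alpha)); apply: measurable_funB.
  by apply: (measurableT_comp (measurable_frac_kernel _)); apply: measurable_funB.
pose F (z : R * R) : \bar R := (g^-1 * (K z.1 z.2 * phi z.2))%:E.
have mF : measurable_fun [set: R * R] F.
  apply/measurable_EFinP; apply: measurable_funM => //; apply: measurable_funM => //.
  exact: (measurableT_comp mphi).
have intK r : (\int[mu]_s (K s r)%:E = (frac_kernel 1 (t - r) * (Gamma alpha * g))%:E)%E.
  have h : measurable_fun [set: R] (fun s => (K s r)%:E).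
    by apply/measurable_EFinP; exact: (measurable_fun_pair1 (f := fun z : R * R => K z.1 z.2) r mK).
  rewrite -(ge0_integral_shift (f := fun s => (K s r)%:E) r)//; last by move=> s; rewrite lee_fin.
  have -> : (\int[mu]_s (K (s + r) r)%:E = beta_conv (1 - alpha) alpha (t - r))%E.
    by apply: eq_integral => s _; rewrite /K addrK mulrC; congr (_ * frac_kernel _ _)%:E; ring.
  rewrite beta_convE beta_conv_Gamma// subrK Gamma1 divr1 -EFinM.
  by rewrite [in RHS](mulrC (Gamma alpha)).
have kernel1E r : 0 < r < t -> frac_kernel 1 (t - r) = 1.
  by move=> /andP[_ rt]; rewrite frac_kernelE subr_gt0 rt subrr powRr0.
have kernel1_le1 r : frac_kernel 1 (t - r) <= 1.
  by rewrite frac_kernelE; case: ifP => // _; rewrite subrr powRr0.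
have mKr r : measurable_fun [set: R] (fun s => (K s r)%:E).
  by apply/measurable_EFinP; exact: (measurable_fun_pair1 (f := fun z : R * R => K z.1 z.2) r mK).
have iF : (mu \x mu)%E.-integrable [set: R * R] F.
  apply/(integrable21ltyP mu mu mF).
  apply: (@le_lt_trans _ _ (\int[mu]_r ((Gamma alpha)%:E * `|(phi r)%:E|))%E).
    apply: ge0_le_integral => //.
    - by move=> r _; apply: integral_ge0.
    - by apply: (measurable_fun_fubini_tonelli_G (m1 := mu) (fun z => `|F z|%E)) => //; exact: measurableT_comp.
    - by apply: measurable_funeM; apply: measurableT_comp => //; exact/measurable_EFinP.
    - move=> r _.
      have c0 : 0 <= g^-1 * `|phi r| by rewrite mulr_ge0// invr_ge0 ltW.
      have -> : (\int[mu]_s `|F (s, r)| = (g^-1 * `|phi r|)%:E * \int[mu]_s (K s r)%:E)%E.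
        rewrite -ge0_integralZl_EFin//; [|by move=> s _; rewrite lee_fin|exact: mKr].
        apply: eq_integral => s _; rewrite /F/= normrM normrM ger0_norm ?invr_ge0 ?(ltW g0)//.
        by rewrite (ger0_norm (K0 _ _)) -EFinM; congr EFin; ring.
      rewrite intK -!EFinM lee_fin.
      rewrite [leLHS](_ : _ = (frac_kernel 1 (t - r) * (g^-1 * g)) * (Gamma alpha * `|phi r|)); last by ring.
      rewrite mulVf ?(gt_eqF g0)// mulr1; apply: ler_piMl => //.
      exact: mulr_ge0.
  rewrite ge0_integralZl//; last first.
  - apply: measurableT_comp => //; exact/measurable_EFinP.
  have /integrableP[_ h] := iphi.
  exact: lte_mul_pinfty.
have E : (\int[mu]_r \int[mu]_s F (s, r) = (Gamma alpha * (f t - f 0))%:E)%E.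
  transitivity (\int[mu]_r ((Gamma alpha)%:E * (phi r)%:E))%E.
    apply: eq_integral => r _.
    transitivity ((g^-1 * phi r)%:E * \int[mu]_s (K s r)%:E)%E.
      have iK : mu.-integrable [set: R] (fun s => (K s r)%:E).
        apply/integrableP; split; first exact: mKr.
        under eq_integral do rewrite abse_EFin (ger0_norm (K0 _ _)).
        by rewrite intK ltry.
      transitivity (\int[mu]_s ((g^-1 * phi r)%:E * (K s r)%:E))%E; last exact: integralZl.
      by apply: eq_integral => s _; rewrite /F/= -EFinM; congr EFin; ring.
    rewrite intK -!EFinM; congr EFin; rewrite phiE.
    case: ifPn => [/kernel1E ->|_]; last by rewrite !mulr0 mul0r.
    rewrite mul1r [LHS](_ : _ = Gamma alpha * f^`()%classic r * (g^-1 * g)); last by ring.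
    by rewrite mulVf ?mulr1// gt_eqF.
  rewrite (integralZl measurableT iphi) EFinM; congr (_ * _)%E.
  rewrite -intf /Rintegral fineK; last exact: integrable_fin_num.
  rewrite [RHS]integral_mkcond; apply: eq_integral => r _.
  by rewrite restrict_EFin.
transitivity (\int[mu]_s \int[mu]_r F (s, r))%E; last exact: etrans (Fubini iF) E.
rewrite integral_mkcond; apply: eq_integral => s _.
rewrite patchE mem_setE in_itv/=; case: ifPn => [/andP[s0 st]|nst]; last first.
  rewrite (eq_integral (fun=> 0%E)) ?integral0// => r _.
  rewrite /F /K/= !frac_kernelE phiE; case: ifPn => h1; last by rewrite !mul0r mulr0.
  case: ifPn => h2; last by rewrite mulr0 mul0r mulr0.
  case: ifPn => h3; last by rewrite !mulr0.
  by exfalso; move: nst h1 h2 h3; rewrite !subr_gt0 => nst h1 h2 /andP[h3 _];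
     move: nst; rewrite h1 (lt_trans h3 h2).
rewrite /caputo EFinM EFinM.
rewrite /Rintegral fineK; last by apply: integrable_fin_num => //; exact: icap.
have ics : mu.-integrable `]0, s[ (EFin \o caputo_integrand alpha f s) by exact: icap.
rewrite -/g -integralZl// -integralZl//; last exact: integrableZl.
rewrite integral_mkcond; apply: eq_integral => r _.
rewrite patchE mem_setE in_itv/=; case: ifPn => [/andP[r0 rs]|nrs].
  rewrite /F /K/= !frac_kernelE phiE !subr_gt0 st rs r0 (lt_trans rs st)/=.
  rewrite /caputo_integrand -!EFinM; congr EFin.
  by rewrite (_ : 1 - alpha - 1 = - alpha); ring.
rewrite /F /K/= !frac_kernelE phiE; case: ifPn => h1; last by rewrite !mul0r mulr0.
case: ifPn => h2; last by rewrite mulr0 mul0r mulr0.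
case: ifPn => h3; last by rewrite !mulr0.
by exfalso; move: nrs h2 h3; rewrite subr_gt0 => nrs h2 /andP[h3 _]; move: nrs; rewrite h2 h3.
Qed.

End Volterra.

Section CaputoAtZero.
Context {R : realType}.
Local Notation mu := (@lebesgue_measure R).
Variable alpha : R.
Hypothesis alpha01 : 0 < alpha < 1.
Implicit Types (f : R -> R) (s t : R).

Let a0 : 0 < alpha. Proof. by case/andP: alpha01. Qed.
Let b0 : 0 < 1 - alpha. Proof. by case/andP: alpha01; lra. Qed.

(** An integration by parts in the form of an inequality: psi s = - (t - s)^(-alpha) f s has
    derivative at most - (t - s)^(-alpha) f' s because f >= 0, it starts from
    - t^(-alpha) f 0 < 0, and it tends to 0 at t, because f s = O(t - s) and alpha < 1. *)
Lemma caputo_at_zero_lt0 f t : 0 < t -> caputo_derivable alpha f ->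
  (forall s, 0 < s < t -> 0 <= f s) -> f t = 0 -> 0 < f 0 ->
  caputo alpha f t < 0.
Proof.
move=> t0 cf fge0 ft f00; have [f0 df icap] := cf.
have g0 : 0 < Gamma (1 - alpha) by exact: Gamma_gt0.
rewrite /caputo pmulr_rlt0 ?invr_gt0//.
suff : t `^ (- alpha) * f 0 <= - \int[mu]_(s in `]0, t[) caputo_integrand alpha f t s.
  have : 0 < t `^ (- alpha) * f 0 by rewrite mulr_gt0// powR_gt0.
  by lra.
have it := icap t t0.
pose psi s := - ((t - s) `^ (- alpha) * f s).
rewrite -[leRHS]mulN1r -RintegralZl//.
rewrite -[leLHS]opprK -[leLHS]add0r.
have dpow s : s < t -> is_derive s 1 (fun s => (t - s) `^ (- alpha)) (alpha * (t - s) `^ (- alpha - 1)).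
  move=> st; have st0 : 0 < t - s by rewrite subr_gt0.
  have h1 := is_derive1_powR (- alpha) st0.
  have h2 : is_derive s 1 (fun s => t - s) (-1).
    by apply: is_derive_eq; rewrite add0r mul1r.
  have h3 := @is_derive1_comp _ (@powR R ^~ (- alpha)) (fun s => t - s) s _ _ h1 h2.
  by apply: (is_derive_eq h3); ring.
apply: (increment_le_integral_oo (f := psi) t0).
- by have := integrableZl _ (- 1)%R it => /(_ (measurable_itv _)).
- move=> s /andP[s0 st].
  have h1 := dpow s st.
  have h2 := derivableP (df s s0).
  have h : is_derive s 1 psi (- (alpha * (t - s) `^ (- alpha - 1) * f s + (t - s) `^ (- alpha) * 'D_1 f s)).
    rewrite /psi; apply: is_derive_eq.
    by rewrite -![_ *: _]/(_ * _); ring.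
  split; first exact: ex_derive.
  rewrite derive1E derive_val /caputo_integrand derive1E mulN1r lerN2 lerDr.
  by rewrite !mulr_ge0 ?powR_ge0 ?(ltW a0)// fge0// s0.
- apply: cvgN; apply: cvgM => //.
  have h : {for 0, continuous (fun s => (t - s) `^ (- alpha))}.
    apply: differentiable_continuous; apply/derivable1_diffP.
    by have [] := dpow 0 t0.
  by move: h; rewrite /prop_for /continuous_at /= subr0 => h; exact: cvg_at_right_filter h.
- rewrite -[X in _ --> X]oppr0; apply: cvgN.
  have dNf : derivable (- f) t 1 by apply: derivableN; exact: df.
  have dNlt : (- f)^`()%classic t < (- f)^`()%classic t + 1 by rewrite ltrDl.
  have [e e0 He] := derivable_increment_le dNf dNlt.
  (* The derivative of - f at t bounds f s by c (t - s) near t. *)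
  set c := (- f)^`()%classic t + 1 in He.
  have pcvg : c * (t - s) `^ (1 - alpha) @[s --> t^'-] --> 0.
    rewrite -(mulr0 c); apply: cvgM; first exact: cvg_cst.
    apply/cvg_at_leftP => u [ut ucv].
    have := powR_cvg0 b0; move/cvg_at_rightP => /(_ (fun n => t - u n)); apply; split.
      by move=> n; rewrite subr_gt0.
    rewrite -(subrr t); apply: cvgB => //; exact: cvg_cst.
  apply: (@squeeze_cvgr _ _ _ _ (fun=> 0) _ _ _ 0 (cvg_cst _) pcvg).
  near=> s.
  have st : s < t by near: s; exact: nbhs_left_lt.
  have s0 : 0 < s by near: s; exact: nbhs_left_gt.
  have se : t - e < s by near: s; apply: nbhs_left_gt; lra.
  rewrite mulr_ge0 ?powR_ge0 ?fge0 ?s0//=.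
  have := He s t se; rewrite ltrDl (ltW st) lexx eqxx orbT => /(_ e0 isT isT).
  rewrite /= -[(- f) t]/(- f t) -[(- f) s]/(- f s) ft oppr0 add0r opprK => fs.
  have -> : c * (t - s) `^ (1 - alpha) = (t - s) `^ (- alpha) * (c * (t - s)).
    rewrite powRD; last by rewrite [t - s == 0]gt_eqF ?implybT// subr_gt0.
    by rewrite powRr1 ?subr_ge0 ?(ltW st)//; ring.
  by rewrite ler_wpM2l ?powR_ge0.
Unshelve. all: by end_near. Qed.

End CaputoAtZero.

(** * The rate operator and the Picard iterates *)

Section RateOperator.
Context {R : realType} (k : nat) (lam : 'I_k -> R).
Implicit Types v : nat -> R.

(** The right-hand side of the system as an operator on sequences; on generating functions it
    is the multiplication by [jump_poly]. *)
Definition rateop v (n : nat) : R :=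
  - (\sum_(j < k) lam j) * v n +
  \sum_(j < k | (j.+1 <= n)%N) lam j * v (n - j.+1)%N.

Lemma rateop_sum (N : nat) (c : nat -> nat -> R) (x : nat -> R) n :
  rateop (fun n => \sum_(m < N) c m n * x m) n = \sum_(m < N) rateop (c m) n * x m.
Proof.
under [RHS]eq_bigr do rewrite /rateop mulrDl mulr_suml.
rewrite big_split/= /rateop mulr_sumr exchange_big/=; congr (_ + _).
  by apply: eq_bigr => m _; rewrite mulrA.
by apply: eq_bigr => j _; rewrite mulr_sumr; apply: eq_bigr => m _; rewrite mulrA.
Qed.

Lemma rateopB u v n : rateop (fun n => u n - v n) n = rateop u n - rateop v n.
Proof.
rewrite /rateop mulrBr opprD addrACA; congr (_ + _).
by rewrite -sumrB; apply: eq_bigr => j _; rewrite mulrBr.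
Qed.

Lemma rateop_norm v C n : (forall j, 0 <= lam j) -> (forall m, `|v m| <= C) ->
  `|rateop v n| <= 2 * (\sum_(j < k) lam j) * C.
Proof.
move=> lam0 vC; rewrite /rateop.
have L0 : 0 <= \sum_(j < k) lam j by apply: sumr_ge0.
apply: (le_trans (ler_normD _ _)).
rewrite (_ : 2 * _ * C = (\sum_(j < k) lam j) * C + C * \sum_(j < k) lam j); last by ring.
rewrite normrM normrN (ger0_norm L0); apply: lerD; first by rewrite ler_wpM2l.
apply: (le_trans (ler_norm_sum _ _ _)).
apply: (@le_trans _ _ (\sum_(j < k | (j.+1 <= n)%N) C * lam j)).
  by apply: ler_sum => j _; rewrite normrM ger0_norm// mulrC ler_wpM2r.
have C0 : 0 <= C := le_trans (normr_ge0 _) (vC 0).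
rewrite mulr_sumr [leRHS](bigID (fun j : 'I_k => (j.+1 <= n)%N))/= lerDl.
by apply: sumr_ge0 => j _; rewrite mulr_ge0.
Qed.

End RateOperator.

Section Picard.
Context {R : realType}.
Local Notation mu := (@lebesgue_measure R).
Variable alpha : R.
Hypothesis a0 : 0 < alpha.

(** The Taylor coefficients of the Mittag-Leffler function. *)
Definition ml_coef (n : nat) : R := (Gamma (alpha * n%:R + 1))^-1.

Let an1_gt0 n : 0 < alpha * n%:R + 1.
Proof. by rewrite ltr_wpDl// mulr_ge0// ltW. Qed.

Lemma ml_coef_gt0 n : 0 < ml_coef n.
Proof. by rewrite invr_gt0 Gamma_gt0. Qed.

Lemma ml_coef0 : ml_coef 0 = 1.
Proof. by rewrite /ml_coef mulr0 add0r Gamma1 invr1. Qed.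

(** The Beta integral on ]0, t[. *)
Lemma integral_frac_powR (b t : R) : 0 <= b -> 0 < t ->
  (\int[mu]_(s in `]0%R, t[) ((t - s) `^ (alpha - 1) * s `^ b)%:E =
   (Gamma alpha * Gamma (b + 1) / Gamma (b + 1 + alpha) * t `^ (b + alpha))%:E)%E.
Proof.
move=> b0 t0; have b10 : 0 < b + 1 by rewrite ltr_wpDl.
transitivity (beta_conv (b + 1) alpha t).
  rewrite integral_mkcond; apply: eq_integral => s _.
  rewrite patchE mem_setE in_itv/= !frac_kernelE subr_gt0 addrK.
  case: (ltP 0 s) => _; case: (ltP s t) => _ /=; rewrite ?mul0r ?mulr0//.
  by rewrite mulrC.
rewrite beta_convE beta_conv_Gamma// frac_kernelE t0 -EFinM; congr EFin.
rewrite (_ : b + 1 + alpha - 1 = b + alpha); last by ring.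
by move: (Gamma alpha) (Gamma (b + 1)) (Gamma _) => x y z; ring.
Qed.

Lemma measurable_frac t : measurable_fun [set: R] (fun s => (t - s) `^ (alpha - 1)).
Proof.
by apply: (measurableT_comp (measurable_powR (alpha - 1))); exact: measurable_funB.
Qed.

Lemma integrable_frac (h : R -> R) (C b t : R) : 0 <= b -> 0 < t ->
  measurable_fun `]0, t[ h -> (forall s, 0 < s < t -> `|h s| <= C * s `^ b) ->
  mu.-integrable `]0, t[ (EFin \o (fun s => (t - s) `^ (alpha - 1) * h s)).
Proof.
move=> b0 t0 mh hC.
have ipow : mu.-integrable `]0, t[ (fun s => ((t - s) `^ (alpha - 1) * s `^ b)%:E).
  apply/integrableP; split.
    apply/measurable_EFinP; apply: measurable_funM; apply: measurable_funTS => //.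
    exact: measurable_frac.
  under eq_integral do rewrite abse_EFin ger0_norm ?mulr_ge0 ?powR_ge0//.
  by rewrite integral_frac_powR// ltry.
apply: (@le_integrable _ _ _ mu _ _ _ (fun s => C%:E * ((t - s) `^ (alpha - 1) * s `^ b)%:E)%E) => //.
- apply/measurable_EFinP; apply: measurable_funM => //.
  by apply: measurable_funTS; exact: measurable_frac.
- move=> s /=; rewrite in_itv/= => st; rewrite lee_fin normrM.
  apply: (le_trans _ (ler_norm _)); rewrite ger0_norm ?powR_ge0//.
  by rewrite mulrCA ler_wpM2l ?powR_ge0// hC.
- exact: integrableZl.
Qed.

(** The coefficients of the Mittag-Leffler function are those that one fractional
    integration of order alpha sends to the next one, up to the constant Gamma alpha. *)
Lemma ml_coef_step m t : 0 < t ->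
  \int[mu]_(s in `]0, t[) ((t - s) `^ (alpha - 1) * (ml_coef m * s `^ (alpha * m%:R))) =
  Gamma alpha * (ml_coef m.+1 * t `^ (alpha * m.+1%:R)).
Proof.
move=> t0.
have am0 : 0 <= alpha * m%:R by rewrite mulr_ge0// ltW.
under eq_Rintegral do rewrite mulrCA.
rewrite RintegralZl//; last first.
  apply: (@integrable_frac _ 1 (alpha * m%:R)) => //; first exact: measurable_funTS.
  by move=> s _; rewrite mul1r ger0_norm ?powR_ge0.
rewrite /Rintegral integral_frac_powR//= /ml_coef.
rewrite -[m.+1%:R]natr1 mulrDr mulr1.
have := Gamma_gt0 (an1_gt0 m); move: (Gamma (alpha * m%:R + 1)) => g g0.
have : 0 < Gamma (alpha * m%:R + 1 + alpha) by rewrite Gamma_gt0// addr_gt0.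
rewrite (_ : alpha * m%:R + alpha + 1 = alpha * m%:R + 1 + alpha); last by ring.
by move: (Gamma alpha) (Gamma _) => x y y0; field; rewrite ?gt_eqF.
Qed.

Variables (k : nat) (lam : 'I_k -> R).
Hypothesis lam0 : forall j, 0 <= lam j.
Local Notation A := (rateop lam).
Local Notation delta := (fun n : nat => (n == 0)%:R : R).
Let L := \sum_(j < k) lam j.
Let L0 : 0 <= L. Proof. exact: sumr_ge0. Qed.

(** The N-th Picard iterate of the Volterra equations, started from 0 (see
    [picard_sum_volterra]). *)
Definition picard_sum N n t : R :=
  \sum_(m < N) iter m A delta n * (ml_coef m * t `^ (alpha * m%:R)).

Variable p : nat -> R -> R.
Hypothesis p_le1 : forall (n : nat) (t : R), 0 < t -> `|p n t| <= 1.
Hypothesis mp : forall (n : nat) (t : R), 0 < t -> measurable_fun `]0, t[ (p n).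
Hypothesis p_volterra : forall (n : nat) (t : R), 0 < t ->
  \int[mu]_(s in `]0, t[) ((t - s) `^ (alpha - 1) * A (p^~ s) n) =
  Gamma alpha * (p n t - delta n).

Let mA (q : nat -> R -> R) (n : nat) (t : R) : (forall n, measurable_fun `]0, t[ (q n)) ->
  measurable_fun `]0, t[ (fun s => A (q^~ s) n).
Proof.
move=> mq.
rewrite (_ : (fun s => _) = fun s => - L * q n s +
    \sum_(j < k) (if (j.+1 <= n)%N then lam j * q (n - j.+1)%N s else 0)); last first.
  by apply/funext => s; rewrite /rateop; congr (_ + _); exact: big_mkcond.
apply: measurable_funD; first exact: measurable_funM.
apply: measurable_sum => j; case: (j.+1 <= n)%N; last exact: measurable_cst.
by apply: measurable_funM; [exact: measurable_cst|exact: mq].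
Qed.

Let mpic (N n : nat) (t : R) : measurable_fun `]0, t[ (picard_sum N n).
Proof.
apply: measurable_sum => m; apply: measurable_funM => //; apply: measurable_funM => //.
exact: measurable_funTS.
Qed.

Lemma picard_sum_volterra N n t : 0 < t ->
  \int[mu]_(s in `]0, t[) ((t - s) `^ (alpha - 1) * A ((picard_sum N)^~ s) n) =
  Gamma alpha * (picard_sum N.+1 n t - delta n).
Proof.
move=> t0.
have E s : A ((picard_sum N)^~ s) n =
    \sum_(m < N) iter m.+1 A delta n * (ml_coef m * s `^ (alpha * m%:R)).
  exact: (rateop_sum _ _ (fun m => iter m A delta) (fun m => ml_coef m * s `^ (alpha * m%:R))).
under eq_Rintegral do rewrite E.
rewrite /picard_sum big_ord_recl/= ml_coef0 mulr0 powRr0 !mulr1 [X in _ = _ * X]addrAC subrr add0r.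
clear E; elim: N => [|N ih].
  rewrite big_ord0 mulr0.
  under eq_Rintegral do rewrite big_ord0 mulr0.
  by rewrite /Rintegral integral0.
under eq_Rintegral do rewrite big_ord_recr/= mulrDr.
rewrite RintegralD//.
- rewrite ih big_ord_recr/= mulrDr; congr (_ + _).
  under eq_Rintegral do rewrite mulrCA.
  rewrite RintegralZl//; last first.
    apply: (@integrable_frac _ (ml_coef N) (alpha * N%:R)) => //.
    - by rewrite mulr_ge0// ltW.
    - by apply: measurable_funM => //; exact: measurable_funTS.
    - by move=> s _; rewrite ger0_norm// mulr_ge0 ?powR_ge0// ltW ?ml_coef_gt0.
  by rewrite ml_coef_step// mulrCA.
- apply: (@integrable_frac _ (\sum_(m < N) `|iter m.+1 A delta n| * (ml_coef m * t `^ (alpha * m%:R))) 0) => //.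
  + apply: measurable_sum => m; apply: measurable_funM => //; apply: measurable_funM => //.
    exact: measurable_funTS.
  + move=> s /andP[s0 st]; rewrite powRr0 mulr1.
    apply: (le_trans (ler_norm_sum _ _ _)); apply: ler_sum => m _.
    rewrite normrM ler_wpM2l// normrM !ger0_norm ?powR_ge0 ?(ltW (ml_coef_gt0 _))//.
    rewrite ler_wpM2l ?(ltW (ml_coef_gt0 _))//.
    apply: ge0_ler_powR; [by rewrite mulr_ge0// ltW|by rewrite nnegrE ltW|
      by rewrite nnegrE ltW|exact: ltW].
- apply: (@integrable_frac _ (`|iter N.+1 A delta n| * ml_coef N) (alpha * N%:R)) => //.
  + by rewrite mulr_ge0// ltW.
  + by apply: measurable_funM => //; apply: measurable_funM => //; exact: measurable_funTS.
  + move=> s _; rewrite normrM -mulrA ler_wpM2l// ger0_norm// mulr_ge0 ?powR_ge0//.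
    exact: ltW (ml_coef_gt0 _).
Qed.

(** The difference with the solution satisfies the homogeneous equation, so every step costs
    one application of [rateop], of norm at most 2 L, and one fractional integration of the
    previous bound, starting from |p| <= 1. *)
Lemma picard_error N n t : 0 < t ->
  `|p n t - picard_sum N n t| <= (2 * L) ^+ N * (ml_coef N * t `^ (alpha * N%:R)).
Proof.
elim: N n t => [|N ih] n t t0.
  by rewrite /picard_sum big_ord0 subr0 expr0 mul1r ml_coef0 mulr0 powRr0 mulr1 p_le1.
have ga0 : 0 < Gamma alpha by exact: Gamma_gt0.
have cN0 := ltW (ml_coef_gt0 N).
have aN0 : 0 <= alpha * N%:R by rewrite mulr_ge0// ltW.
pose d s n := p n s - picard_sum N n s.
have dE : Gamma alpha * (p n t - picard_sum N.+1 n t) =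
   \int[mu]_(s in `]0, t[) ((t - s) `^ (alpha - 1) * A (d s) n).
  rewrite (_ : Gamma alpha * _ = Gamma alpha * (p n t - delta n) -
     Gamma alpha * (picard_sum N.+1 n t - delta n)); last by ring.
  rewrite -p_volterra// -picard_sum_volterra// -RintegralB//.
  - by apply: eq_Rintegral => s _; rewrite /d rateopB mulrBr.
  - apply: (@integrable_frac _ (2 * L) 0) => //; first by apply: mA => m; exact: mp.
    move=> s /andP[s0 _]; rewrite powRr0; apply: rateop_norm => // m; exact: p_le1.
  - pose C := \sum_(m < N) `|iter m.+1 A delta n| * (ml_coef m * t `^ (alpha * m%:R)).
    apply: (@integrable_frac _ C 0) => //; first by apply: mA.
    move=> s /andP[s0 st]; rewrite powRr0 mulr1.
    rewrite (rateop_sum _ _ (fun m => iter m A delta) (fun m => ml_coef m * s `^ (alpha * m%:R))).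
    apply: (le_trans (ler_norm_sum _ _ _)); apply: ler_sum => m _.
    rewrite normrM ler_wpM2l// normrM !ger0_norm ?powR_ge0 ?(ltW (ml_coef_gt0 _))//.
    rewrite ler_wpM2l ?(ltW (ml_coef_gt0 _))//.
    apply: ge0_ler_powR; [by rewrite mulr_ge0// ltW|by rewrite nnegrE ltW|
      by rewrite nnegrE ltW|exact: ltW].
have dle s : 0 < s -> `|A (d s) n| <= (2 * L) ^+ N.+1 * (ml_coef N * s `^ (alpha * N%:R)).
  move=> s0; rewrite exprS -mulrA; apply: rateop_norm => // m; exact: ih.
have md : measurable_fun `]0, t[ (fun s => A (d s) n).
  by apply: (mA (q := fun n s => d s n)) => m; apply: measurable_funB => //; exact: mp.
have id : mu.-integrable `]0, t[ (EFin \o (fun s => (t - s) `^ (alpha - 1) * A (d s) n)).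
  apply: (@integrable_frac _ ((2 * L) ^+ N.+1 * ml_coef N) (alpha * N%:R)) => //.
  by move=> s /andP[s0 _]; rewrite -mulrA; exact: dle.
rewrite -(ler_pM2l ga0) -{1}(ger0_norm (ltW ga0)) -normrM dE.
apply: (le_trans (le_normr_Rintegral _ id)) => //.
have ip : mu.-integrable `]0, t[ (EFin \o (fun s => (t - s) `^ (alpha - 1) * (ml_coef N * s `^ (alpha * N%:R)))).
  apply: (@integrable_frac _ (ml_coef N) (alpha * N%:R)) => //.
  - by apply: measurable_funM => //; exact: measurable_funTS.
  - by move=> s _; rewrite ger0_norm// mulr_ge0 ?powR_ge0.
rewrite [leRHS]mulrCA -ml_coef_step// -RintegralZl//.
apply: le_Rintegral => //.
- by have := integrable_norm id.
- by have := integrableZl _ ((2 * L) ^+ N.+1) ip => /(_ (measurable_itv _)).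
- move=> s; rewrite /= in_itv/= => /andP[s0 st].
  by rewrite normrM ger0_norm ?powR_ge0// mulrCA ler_wpM2l ?powR_ge0//; exact: dle.
Qed.

End Picard.

(** * Entire power series *)

Section EntireSeries.
Context {R : realType}.
Implicit Types (c d : R ^nat) (x : R).

Definition entire c := forall x, cvgn (pseries c x).
Definition psum c x : R := limn (pseries c x).

(** A bound on the terms at 2 |x| makes the series at x dominated by a geometric one. *)
Lemma entire_bounded c : (forall x, 0 <= x -> exists C, forall n, `|c n| * x ^+ n <= C) -> entire c.
Proof.
move=> H x; have [C HC] := H (2 * `|x|) (mulr_ge0 (ler0n _ 2) (normr_ge0 x)).
apply: normed_cvg.
have C0 : 0 <= C by apply: le_trans (HC 0); rewrite mulr_ge0.
apply: (@series_le_cvg _ _ (geometric C 2^-1)).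
- by move=> n /=; exact: normr_ge0.
- by move=> n; rewrite geometric_ge0.
- move=> n; rewrite /geometric/= normrM normrX.
  rewrite exprVn ler_pdivlMr ?exprn_gt0//.
  by apply: le_trans (HC n); rewrite exprMn -mulrA (mulrC _ (2 ^+ n)).
- by apply: is_cvg_geometric_series; rewrite ger0_norm//; lra.
Qed.

Lemma entire_boundedE c x : entire c -> exists C, forall n, `|c n| * `|x| ^+ n <= C.
Proof.
move=> ec; have [K [_ HK]] := cvg_series_bounded (ec x).
exists (K + 1) => n; rewrite -normrX -normrM.
exact: (HK (K + 1) ltac:(by rewrite ltrDl) n I).
Qed.

Lemma natr_le_exp2 n : n%:R <= 2 ^+ n :> R.
Proof. by rewrite -natrX ler_nat ltnW// ltn_expl. Qed.

Lemma entire_diffs c : entire c -> entire (pseries_diffs c).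
Proof.
move=> ec; apply: entire_bounded => x x0.
have [C HC] := entire_boundedE (2 * (x + 1)) ec; exists C => n.
apply: le_trans (HC n.+1); rewrite /pseries_diffs normrM [`|n.+1%:R|]ger0_norm//.
rewrite [`|2 * _|]ger0_norm; last by lra.
rewrite (mulrC n.+1%:R) -mulrA ler_wpM2l// exprMn; apply: ler_pM => //.
- exact: exprn_ge0.
- exact: natr_le_exp2.
- rewrite exprS; apply: (@le_trans _ _ ((x + 1) ^+ n)).
    by rewrite lerXn2r ?nnegrE//; lra.
  by rewrite ler_peMl ?exprn_ge0//; lra.
Qed.

Lemma psum_cvg c x : entire c -> pseries c x @ \oo --> psum c x.
Proof. by move=> ec; exact: ec. Qed.

Lemma psum_derive c x : entire c -> is_derive x 1 (psum c) (psum (pseries_diffs c) x).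
Proof.
move=> ec; apply: (@pseries_snd_diffs _ c (`|x| + 1)) => //.
- exact/entire_diffs.
- exact/entire_diffs/entire_diffs.
- by rewrite [ltRHS]ger0_norm ?addr_ge0// ltrDl.
Qed.

Lemma entireD c d : entire c -> entire d -> entire (fun n => c n + d n).
Proof.
move=> ec ed x; rewrite (_ : pseries _ x = pseries c x + pseries d x).
  by apply: is_cvgD.
rewrite /pseries -seriesD; congr series.
by apply/funext => i /=; rewrite mulrDl.
Qed.

Lemma psumD c d x : entire c -> entire d -> psum (fun n => c n + d n) x = psum c x + psum d x.
Proof.
move=> ec ed; apply/cvg_lim => //.
rewrite (_ : pseries _ x = pseries c x + pseries d x).
  by apply: cvgD; exact: psum_cvg.
rewrite /pseries -seriesD; congr series.
by apply/funext => i /=; rewrite mulrDl.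
Qed.

Lemma entireZ a c : entire c -> entire (fun n => a * c n).
Proof.
move=> ec x; rewrite (_ : pseries _ x = (fun n => a * pseries c x n)).
  by apply: is_cvgMr.
by apply/funext => n; rewrite /pseries /series/= mulr_sumr; apply: eq_bigr => i _; rewrite mulrA.
Qed.

Lemma psumZ a c x : entire c -> psum (fun n => a * c n) x = a * psum c x.
Proof.
move=> ec; apply/cvg_lim => //.
rewrite (_ : pseries _ x = (fun n => a * pseries c x n)).
  by apply: cvgMr; exact: psum_cvg.
by apply/funext => n; rewrite /pseries /series/= mulr_sumr; apply: eq_bigr => i _; rewrite mulrA.
Qed.

(** The coefficients of x times the series. *)
Definition pshift c : R ^nat := fun n => if n is m.+1 then c m else 0.

Lemma pshift_cvg c x l : pseries c x @ \oo --> l -> pseries (pshift c) x @ \oo --> x * l.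
Proof.
move=> cl; rewrite -cvg_shiftS/=.
rewrite (_ : (fun _ => _) = (fun n => x * pseries c x n)); first exact: cvgMr.
apply/funext => n; rewrite /pseries /series/= big_nat_recl//= mul0r add0r mulr_sumr.
by apply: eq_bigr => i _; rewrite exprS mulrCA.
Qed.

Lemma entire_shift c : entire c -> entire (pshift c).
Proof. by move=> ec x; apply/cvg_ex; eexists; apply: pshift_cvg; exact: psum_cvg. Qed.

Lemma psum_shift c x : entire c -> psum (pshift c) x = x * psum c x.
Proof. by move=> ec; apply/cvg_lim => //; apply: pshift_cvg; exact: psum_cvg. Qed.

Lemma psum_natM c x : entire c -> psum (fun n => n%:R * c n) x = x * psum (pseries_diffs c) x.
Proof.
move=> ec; rewrite -psum_shift; last exact: entire_diffs.
by congr psum; apply/funext => -[|n] /=; rewrite ?mul0r.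
Qed.

Lemma entire_natM c : entire c -> entire (fun n => n%:R * c n).
Proof.
move=> /entire_diffs/entire_shift; rewrite (_ : pshift _ = fun n => n%:R * c n)//.
by apply/funext => -[|n] /=; rewrite ?mul0r.
Qed.

Lemma psum_le c d x : 0 <= x -> entire c -> entire d -> (forall n, c n <= d n) ->
  psum c x <= psum d x.
Proof.
move=> x0 ec ed cd; apply: ler_lim; [exact: ec|exact: ed|apply: nearW => n].
by apply: ler_sum => i _; rewrite ler_wpM2r// exprn_ge0.
Qed.

Lemma pseries_le_psum c x n : 0 <= x -> entire c -> (forall n, 0 <= c n) ->
  pseries c x n <= psum c x.
Proof.
move=> x0 ec c0; apply: nondecreasing_cvgn_le; last exact: ec.
by apply: nondecreasing_series => i _ _; rewrite mulr_ge0// exprn_ge0.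
Qed.

Lemma term_le_psum c x n : 0 <= x -> entire c -> (forall n, 0 <= c n) ->
  c n * x ^+ n <= psum c x.
Proof.
move=> x0 ec c0; apply: le_trans (pseries_le_psum n.+1 x0 ec c0).
rewrite /pseries /series/= big_nat_recr//= lerDr.
by apply: sumr_ge0 => i _; rewrite mulr_ge0// exprn_ge0.
Qed.

Lemma psum0 c : psum c 0 = c 0.
Proof.
apply/cvg_lim => //; rewrite -cvg_shiftS/=; apply: cvg_near_cst; apply: nearW => n.
rewrite /pseries /series/= big_nat_recl//= expr0 mulr1 big1 ?addr0// => i _.
by rewrite expr0n/= mulr0.
Qed.

(** Lets polynomials take part in identities between entire series. *)
Lemma psum_finite c m x : (forall n, (m <= n)%N -> c n = 0) ->
  entire c /\ psum c x = \sum_(i < m) c i * x ^+ i.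
Proof.
move=> c0.
have cv y : pseries c y @ \oo --> \sum_(i < m) c i * y ^+ i.
  apply: cvg_near_cst; near=> n.
  have mn : (m <= n)%N by near: n; exact: nbhs_infty_ge.
  rewrite /pseries /series/= (@big_cat_nat _ _ _ m)//= [X in _ + X]big_nat_cond.
  rewrite [X in _ + X]big1 ?addr0 ?big_mkord// => i; rewrite andbT => /andP[mi _].
  by rewrite c0// mul0r.
split; last by apply/cvg_lim.
by move=> y; apply/cvg_ex; eexists; exact: cv.
Unshelve. all: by end_near. Qed.

End EntireSeries.

(** * The generating function as a Mittag-Leffler function *)

Section MittagLeffler.
Context {R : realType}.
Variable alpha : R.
Hypothesis a0 : 0 < alpha.

Lemma powR_root (x : R) : 0 <= x -> (x `^ alpha^-1) `^ alpha = x.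
Proof. by move=> x0; rewrite -powRrM mulVf ?gt_eqF// powRr1. Qed.

Lemma powR_natM (v : R) n : v `^ (alpha * n%:R) = (v `^ alpha) ^+ n.
Proof. by rewrite powRrM powR_mulrn// powR_ge0. Qed.

(** [Gamma_ge] with exponent alpha n: a single term of E(v^alpha) is at most exp v. *)
Lemma ml_coef_term n (v : R) : 0 <= v -> ml_coef alpha n * (v `^ alpha) ^+ n <= expR v.
Proof.
move=> v0; rewrite -powR_natM /ml_coef mulrC ler_pdivrMr; last first.
  by rewrite Gamma_gt0// ltr_wpDl// mulr_ge0// ltW.
rewrite -ler_pdivrMl ?expR_gt0// -expRN mulrC.
by apply: Gamma_ge => //; rewrite mulr_ge0// ltW.
Qed.

Lemma ml_entire : entire (ml_coef alpha).
Proof.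
apply: entire_bounded => x x0; exists (expR (x `^ alpha^-1)) => n.
rewrite ger0_norm ?(ltW (ml_coef_gt0 _ _))//.
by rewrite -{1}(powR_root x0); apply: ml_coef_term; exact: powR_ge0.
Qed.

End MittagLeffler.

Section GeneratingFunction.
Context {R : realType} (k : nat) (lam : 'I_k -> R).
Hypothesis lam0 : forall j, 0 <= lam j.
Local Notation A := (rateop lam).
Local Notation delta := (fun n : nat => (n == 0)%:R : R).
Let L := \sum_(j < k) lam j.
Let L0 : 0 <= L. Proof. exact: sumr_ge0. Qed.

(** The exponent of the compound Poisson process: at time s its generating function is
    exp(s w(u)), with w the polynomial below. *)
Definition jump_poly : {poly R} := \sum_(j < k) lam j *: 'X^(j.+1) - L%:P.
(** Differs from [jump_poly] by the sign of the constant term, so that its powers dominate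
    those of [jump_poly] coefficientwise. *)
Definition jump_majorant : {poly R} := \sum_(j < k) lam j *: 'X^(j.+1) + L%:P.

Let coef_jump (q : {poly R}) n :
  ((\sum_(j < k) lam j *: 'X^(j.+1)) * q)`_n =
  \sum_(j < k | (j.+1 <= n)%N) lam j * q`_(n - j.+1).
Proof.
rewrite mulr_suml coef_sum [RHS]big_mkcond/=; apply: eq_bigr => j _.
by rewrite -scalerAl coefZ coefXnM ltnNge; case: (j.+1 <= n)%N; rewrite ?mulr0.
Qed.

Lemma rateop_jump_poly (q : {poly R}) n : A (fun n => q`_n) n = (jump_poly * q)`_n.
Proof. by rewrite /rateop mulrBl coefB coef_jump coefCM addrC mulNr. Qed.

Lemma iter_rateop m n : iter m A delta n = (jump_poly ^+ m)`_n.
Proof.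
elim: m n => [|m ih] n; first by rewrite expr0 coef1.
rewrite exprS -rateop_jump_poly iterS; congr rateop; exact/funext.
Qed.

Lemma jump_poly_norm m n : `|(jump_poly ^+ m)`_n| <= (jump_majorant ^+ m)`_n.
Proof.
elim: m n => [|m ih] n; first by rewrite !expr0 coef1 ger0_norm.
rewrite !exprS -rateop_jump_poly mulrDl coefD coef_jump coefCM addrC /rateop.
apply: (le_trans (ler_normD _ _)); apply: lerD.
  by rewrite normrM normrN (ger0_norm L0) ler_wpM2l.
apply: (le_trans (ler_norm_sum _ _ _)); apply: ler_sum => j _.
by rewrite normrM ger0_norm// ler_wpM2l.
Qed.

Lemma sum_coef_le_horner (q : {poly R}) (x : R) K : 0 <= x -> (forall n, 0 <= q`_n) ->
  \sum_(0 <= n < K) q`_n * x ^+ n <= q.[x].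
Proof.
move=> x0 q0; rewrite (@horner_coef_wide _ (maxn K (size q))); last exact: leq_maxr.
rewrite -(big_mkord xpredT (fun i => q`_i * x ^+ i)).
rewrite [leRHS](@big_cat_nat _ _ _ K)//= ?leq_maxl// lerDl.
by apply: sumr_ge0 => i _; rewrite mulr_ge0// exprn_ge0.
Qed.

Lemma sum_coef_horner (q : {poly R}) (x : R) K : (size q <= K)%N ->
  \sum_(0 <= n < K) q`_n * x ^+ n = q.[x].
Proof. by move=> qK; rewrite (@horner_coef_wide _ K)// big_mkord. Qed.

Variable (b : R ^nat).
Hypothesis b_ge0 : forall m, 0 <= b m.
Hypothesis b_entire : entire b.
Variable p : R ^nat.
Hypothesis p_approx : forall N n,
  `|p n - \sum_(m < N) iter m A delta n * b m| <= (2 * L) ^+ N * b N.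

(** The double series sum_m b_m sum_n (w^m)_n u^n can be summed over n first, because it is
    dominated by sum_m b_m W^m with W the value at |u| of the majorant.  The approximation
    hypothesis has an error uniform in n; on a partial sum over n < K it disappears by letting
    N' tend to infinity, leaving the tail T of the dominating series. *)
Lemma generating_function (u : R) : pseries p u @ \oo --> psum b jump_poly.[u].
Proof.
(* The ratio of the dominating series. *)
pose W := jump_majorant.[`|u|].
have maj0 m n : 0 <= (jump_majorant ^+ m)`_n := le_trans (normr_ge0 _) (jump_poly_norm m n).
have W0 : 0 <= W.
  rewrite /W -[jump_majorant]expr1; apply: le_trans (sum_coef_le_horner 0 _ _) => //.
  by rewrite big_geq.
have row N n : `|p n - \sum_(m < N) (jump_poly ^+ m)`_n * b m| <= (2 * L) ^+ N * b N.
  by under eq_bigr do rewrite -iter_rateop; exact: p_approx.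
have err0 : (2 * L) ^+ n * b n @[n --> \oo] --> 0.
  have h : cvgn (pseries b (2 * L)) by exact: b_entire.
  have := cvg_series_cvg_0 h.
  rewrite [X in X @ _ --> _ -> _](_ : _ = fun n => (2 * L) ^+ n * b n)//.
  by apply/funext => n; rewrite /= mulrC.
pose T N := psum b W - pseries b W N.
have T0 : T n @[n --> \oo] --> 0.
  by rewrite -(subrr (psum b W)); apply: cvgB; [exact: cvg_cst|exact: psum_cvg].
have bound N K : `|\sum_(0 <= n < K) (p n - \sum_(m < N) (jump_poly ^+ m)`_n * b m) * u ^+ n| <= T N.
  pose U := \sum_(0 <= n < K) `|u| ^+ n.
  have cv : T N + ((2 * L) ^+ N' * b N') * U @[N' --> \oo] --> T N.
    rewrite -[X in _ --> X]addr0 -(mul0r U); apply: cvgD; first exact: cvg_cst.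
    by apply: cvgM => //; exact: cvg_cst.
  apply: (cvgr_to_ge cv); near=> N'.
  have NN' : (N <= N')%N by near: N'; exact: nbhs_infty_ge.
  have tail : \sum_(N <= m < N') W ^+ m * b m <= T N.
    rewrite lerBrDl.
    apply: le_trans (pseries_le_psum N' W0 b_entire b_ge0).
    rewrite /pseries /series/= [leRHS](@big_cat_nat _ _ _ N)//= lerD2l.
    by apply: ler_sum => i _; rewrite mulrC.
  apply: (le_trans (ler_norm_sum _ _ _)).
  apply: (@le_trans _ _ (\sum_(0 <= n < K)
      (\sum_(N <= m < N') (jump_majorant ^+ m)`_n * b m + (2 * L) ^+ N' * b N') * `|u| ^+ n)).
    apply: ler_sum => n _; rewrite normrM normrX ler_wpM2r ?exprn_ge0//.
    have -> : p n - \sum_(m < N) (jump_poly ^+ m)`_n * b m =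
      \sum_(N <= m < N') (jump_poly ^+ m)`_n * b m +
      (p n - \sum_(m < N') (jump_poly ^+ m)`_n * b m).
      rewrite -!(big_mkord xpredT (fun m => (jump_poly ^+ m)`_n * b m)).
      by rewrite (@big_cat_nat _ _ _ N 0 N')//=; ring.
    apply: (le_trans (ler_normD _ _)); apply: lerD; last exact: row.
    apply: (le_trans (ler_norm_sum _ _ _)); apply: ler_sum => m _.
    by rewrite normrM (ger0_norm (b_ge0 _)) ler_wpM2r// jump_poly_norm.
  under eq_bigr do rewrite mulrDl.
  rewrite big_split/= -mulr_sumr lerD2r.
  apply: le_trans tail.
  under eq_bigr do rewrite mulr_suml.
  rewrite exchange_big/=; apply: ler_sum => m _.
  under eq_bigr do rewrite mulrAC.
  rewrite -mulr_suml ler_wpM2r// -horner_exp.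
  exact: sum_coef_le_horner.
apply/cvgrPdist_le => e e0.
have e20 : 0 < e / 2 by rewrite divr_gt0.
have [N [TN EN]] : exists N, T N <= e / 2 /\
    `|psum b jump_poly.[u] - pseries b jump_poly.[u] N| <= e / 2.
  have h1 : \forall N \near \oo, T N <= e / 2 by exact: cvgr_le T0 _ e20.
  have h2 : \forall N \near \oo, `|psum b jump_poly.[u] - pseries b jump_poly.[u] N| <= e / 2.
    by have /cvgrPdist_le := @psum_cvg _ _ jump_poly.[u] b_entire; apply.
  near \oo => N; exists N; split; near: N; [exact: h1|exact: h2].
near=> K.
have KN : (\max_(m < N) size (jump_poly ^+ m)%R <= K)%N.
  by near: K; exact: nbhs_infty_ge.
have partial : pseries b jump_poly.[u] N =
    \sum_(0 <= n < K) (\sum_(m < N) (jump_poly ^+ m)`_n * b m) * u ^+ n.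
  under [RHS]eq_bigr do rewrite mulr_suml.
  rewrite exchange_big/= /pseries /series/= big_mkord; apply: eq_bigr => m _.
  under [RHS]eq_bigr do rewrite mulrAC.
  rewrite -mulr_suml mulrC -horner_exp sum_coef_horner//.
  by apply: leq_trans KN; exact: leq_bigmax.
have -> : psum b jump_poly.[u] - pseries p u K =
  (psum b jump_poly.[u] - pseries b jump_poly.[u] N) -
  \sum_(0 <= n < K) (p n - \sum_(m < N) (jump_poly ^+ m)`_n * b m) * u ^+ n.
  under [in RHS]eq_bigr do rewrite mulrBl.
  rewrite sumrB -partial /pseries /series/=; ring.
apply: (le_trans (ler_normB _ _)).
by rewrite (splitr e); apply: lerD => //; apply: le_trans TN; exact: bound.
Unshelve. all: by end_near. Qed.

End GeneratingFunction.

(** * Convolution roots of laws on the non-negative integers *)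

Section ConvolutionPowers.
Context {R : realType}.
Local Open Scope ereal_scope.
Implicit Types (nu M : probability R R) (A B C : set R).

Definition addpair (z : R * R) : R := (z.1 + z.2)%R.

Lemma measurable_addpair : measurable_fun [set: R * R] addpair.
Proof. exact: measurable_funD. Qed.

HB.instance Definition _ := isMeasurableFun.Build _ _ _ _ addpair measurable_addpair.

(** The law of the sum of two independent variables.  As a probability, unlike the iterated
    set functions of [convolution_power], it allows monotonicity and union bounds. *)
Definition conv_prob nu M : probability R R := distribution (nu \x M) addpair.

Fixpoint conv_prob_power nu (m : nat) : probability R R :=
  if m is m.+1 then conv_prob nu (conv_prob_power nu m) else \d_(0%R : R).

Lemma measurable_addpair_preimage C : measurable C -> measurable (addpair @^-1` C).
Proof. by move=> mC; rewrite -[X in measurable X]setTI; exact: measurable_addpair. Qed.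

Lemma conv_probE nu M C : conv_prob nu M C = (nu \x M) (addpair @^-1` C).
Proof. by []. Qed.

Lemma convolution_powerE nu m A : measurable A ->
  convolution_power nu m A = conv_prob_power nu m A.
Proof.
elim: m A => [//|m ih] A mA.
transitivity (\int[nu]_x conv_prob_power nu m (xsection (addpair @^-1` A) x)); last by [].
apply: eq_integral => x _.
have -> : [set y | A (x + y)%R] = xsection (addpair @^-1` A) x.
  by apply/seteqP; split => y /=; rewrite /xsection/= inE.
rewrite [LHS]ih//; apply: measurable_xsection; exact: measurable_addpair_preimage.
Qed.

(** Independence: X in A and Y in B have probability nu A * M B together. *)
Lemma conv_prob_ge nu M A B C : measurable A -> measurable B -> measurable C ->
  (forall x y, A x -> B y -> C (x + y)%R) -> nu A * M B <= conv_prob nu M C.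
Proof.
move=> mA mB mC ABC; rewrite conv_probE -product_measure1E//.
apply: le_measure; rewrite ?inE; [exact: measurableX|exact: measurable_addpair_preimage|].
by move=> [x y] [/= Ax By]; exact: ABC.
Qed.

(** A union bound on the events X in A and Y in B. *)
Lemma conv_prob_le nu M A B C : measurable A -> measurable B -> measurable C ->
  (forall x y, C (x + y)%R -> A x \/ B y) -> conv_prob nu M C <= nu A + M B.
Proof.
move=> mA mB mC ABC; rewrite conv_probE.
have -> : nu A = (nu \x M) (A `*` setT).
  have := product_measure1E nu M mA measurableT.
  by rewrite [X in _ * X](_ : _ = 1) ?mule1//; exact: probability_setT.
have -> : M B = (nu \x M) (setT `*` B).
  have := product_measure1E nu M measurableT mB.
  by rewrite [X in X * _](_ : _ = 1) ?mul1e//; exact: probability_setT.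
apply: (@le_trans _ _ ((nu \x M) ((A `*` setT) `|` (setT `*` B)))); last first.
  by apply: measureU2; exact: measurableX.
apply: le_measure; rewrite ?inE.
- exact: measurable_addpair_preimage.
- by apply: measurableU; exact: measurableX.
- by move=> [x y] /= /ABC[]; [left|right].
Qed.

Definition nat_points : set R := range (fun n : nat => n%:R : R).

Lemma measurable_nat_points : measurable nat_points.
Proof.
rewrite (_ : nat_points = \bigcup_n [set n%:R]).
  by apply: bigcupT_measurable => n; exact: measurable_set1.
by apply/seteqP; split => [_ [n _ <-]|_ [n _ ->]]; exists n.
Qed.

End ConvolutionPowers.

Section NatSupport.
Context {R : realType}.
Local Open Scope ereal_scope.
Variables (mu nu : probability R R) (N : nat).
Hypothesis mu_nat : mu (~` nat_points) = 0.
Hypothesis mu0 : 0 < mu [set 0%R].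
Hypothesis muE : forall A, measurable A -> mu A = conv_prob_power nu N.+1 A.

Local Notation M := (conv_prob_power nu).

Let mu_null A : measurable A -> A `<=` ~` nat_points -> mu A = 0.
Proof.
move=> mA AN; apply/eqP; rewrite eq_le measure_ge0 andbT -mu_nat.
apply: le_measure => //; rewrite inE//.
by apply: measurableC; exact: measurable_nat_points.
Qed.

Let neg_itv : set R := `]-oo, 0%R[%classic.

(** If nu charged ]-oo, -e], then N + 1 independent copies would all lie there with positive
    probability, and their sum, of law mu, would be negative. *)
Lemma root_neg_null : nu neg_itv = 0.
Proof.
have neg (e : R) : (0 < e)%R -> nu `]-oo, (- e)%R]%classic = 0.
  move=> e0.
  have h m : nu `]-oo, (- e)%R]%classic ^+ m <= M m `]-oo, (- (m%:R * e))%R]%classic.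
    elim: m => [|m ih].
      by rewrite mul0r oppr0 /= diracE mem_set//= in_itv/=.
    rewrite expeS; apply: (@le_trans _ _ (nu `]-oo, (- e)%R]%classic * M m `]-oo, (- (m%:R * e))%R]%classic)).
      by apply: lee_wpmul2l.
    apply: conv_prob_ge => // x y /=; rewrite !in_itv/= -natr1 mulrDl mul1r; lra.
  have := h N.+1; rewrite -muE//.
  rewrite [X in _ <= X]mu_null//; last first.
    move=> x /=; rewrite in_itv/= => xle [n _ nx].
    have : (0 < N.+1%:R * e)%R by rewrite mulr_gt0.
    have : (0 <= n%:R :> R)%R by [].
    lra.
  move=> h0; apply/eqP.
  have : nu `]-oo, (- e)%R]%classic ^+ N.+1 == 0 by rewrite eq_le h0 expe_ge0.
  by rewrite expe_eq0.
have -> : neg_itv = \bigcup_n `]-oo, (- n.+1%:R^-1)%R]%classic.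
  apply/seteqP; split => x; rewrite /neg_itv /= ?in_itv/=.
    move=> x0; exists (Num.truncn (- x)^-1)%R => //=; rewrite in_itv/=.
    rewrite lerNr invf_ple ?posrE ?oppr_gt0//; apply/ltW/truncnS_gt.
  move=> [n _ /=]; rewrite in_itv/= => xn; apply: le_lt_trans xn _.
  by rewrite oppr_lt0 invr_gt0.
apply/eqP; rewrite eq_le measure_ge0 andbT.
pose F n : set R := `]-oo, (- n.+1%:R^-1)%R]%classic.
have mF n : measurable (F n) by exact: measurable_itv.
have h := measure_sigma_subadditive nu mF (bigcupT_measurable F mF) (@subset_refl _ _).
apply: (le_trans h).
rewrite eseries0// => i _ _; apply: neg.
by rewrite invr_gt0.
Qed.

Lemma power_neg_null m : M m neg_itv = 0.
Proof.
elim: m => [|m ih].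
  by rewrite /= diracE memNset//= /neg_itv/= in_itv/= ltxx.
apply/eqP; rewrite eq_le measure_ge0 andbT.
have -> : (0 = nu neg_itv + M m neg_itv :> \bar R) by rewrite root_neg_null ih adde0.
apply: conv_prob_le; try exact: measurable_itv.
move=> x y; rewrite /neg_itv/= !in_itv/= => xy.
by have [x0|x0] := ltP x 0%R; [left|right; lra].
Qed.

(** If nu({0}) = 0 then X > 0 almost surely, so a sum X + Y with Y >= 0 vanishes with
    probability 0, contrary to the hypothesis on mu. *)
Lemma root_zero_gt0 : 0 < nu [set 0%R].
Proof.
rewrite lt0e measure_ge0 andbT; apply/eqP => nu00.
move: mu0; rewrite muE; last exact: measurable_set1.
apply/negP; rewrite -leNgt.
have -> : (0 = nu (neg_itv `|` [set 0%R]) + M N neg_itv :> \bar R).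
  rewrite power_neg_null adde0; apply/esym/eqP; rewrite eq_le measure_ge0 andbT.
  have -> : (0 = nu neg_itv + nu [set 0%R] :> \bar R) by rewrite root_neg_null nu00 adde0.
  apply: measureU2; [exact: measurable_itv|exact: measurable_set1].
apply: conv_prob_le.
- by apply: measurableU; [exact: measurable_itv|exact: measurable_set1].
- exact: measurable_itv.
- exact: measurable_set1.
- move=> x y /=; rewrite /neg_itv/= !in_itv/= => xy.
  have [x0|x0|x0] := ltrgtP x 0%R; [by left; left| |by left; right].
  by right; lra.
Qed.

Lemma power_zero_gt0 m : 0 < M m [set 0%R].
Proof.
elim: m => [|m ih]; first by rewrite /= diracE mem_set.
apply: (@lt_le_trans _ _ (nu [set 0%R] * M m [set 0%R])).
  by rewrite mule_gt0// root_zero_gt0.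
apply: conv_prob_ge; try exact: measurable_set1.
by move=> x y /= -> ->; rewrite addr0.
Qed.

(** A value of nu outside the integers, added to N copies equal to 0, which have positive
    probability, is a value of mu outside the integers. *)
Lemma root_nat : nu (~` nat_points) = 0.
Proof.
have mN : measurable (~` nat_points : set R).
  by apply: measurableC; exact: measurable_nat_points.
have h : nu (~` nat_points) * M N [set 0%R] <= mu (~` nat_points).
  rewrite muE//; apply: conv_prob_ge => //.
  by move=> x y /= xn ->; rewrite addr0.
move: h; rewrite mu_nat => h.
have : nu (~` nat_points) * M N [set 0%R] == 0.
  by rewrite eq_le h mule_ge0.
by rewrite mule_eq0 (gt_eqF (power_zero_gt0 N)) orbF => /eqP.
Qed.

(** Up to the null events that X is not a natural number or that Y < 0, the event X + Y = n is
    the disjoint union of the events X = j, Y = n - j for j <= n. *)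
Lemma conv_prob_nat m n :
  conv_prob nu (M m) [set n%:R] =
  \sum_(j < n.+1) nu [set j%:R] * M m [set (n - j)%:R].
Proof.
have mx (a b : R) : measurable ([set a] `*` [set b] : set (R * R)).
  by apply: measurableX; exact: measurable_set1.
have mS : measurable (addpair @^-1` [set n%:R : R]).
  by apply: measurable_addpair_preimage; exact: measurable_set1.
have mN : measurable (~` nat_points : set R).
  by apply: measurableC; exact: measurable_nat_points.
pose F (j : 'I_n.+1) : set (R * R) := [set j%:R] `*` [set (n - j)%:R].
have FE : (nu \x M m) (\big[setU/set0]_(j < n.+1) F j) =
    \sum_(j < n.+1) nu [set j%:R] * M m [set (n - j)%:R].
  rewrite measure_bigsetU_ord//.
  - apply: eq_bigr => j _.
    exact: (product_measure1E nu (M m) (measurable_set1 _) (measurable_set1 _)).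
  - move=> j; exact: mx.
  - apply/trivIsetP => i j _ _ ij; apply/seteqP; split => // -[x y] [[/= -> _] [/= /eqP + _]].
    by rewrite eqr_nat => /eqP h; move: ij; rewrite -val_eqE/= h eqxx.
have mU : measurable (\big[setU/set0]_(j < n.+1) F j).
  by apply: bigsetU_measurable => j _; exact: mx.
rewrite conv_probE -FE; apply/eqP; rewrite eq_le; apply/andP; split; last first.
  apply: le_measure; rewrite ?inE//.
  move=> [x y]; rewrite -bigcup_mkord_ord => -[j /= jn [/= -> ->]].
  rewrite /addpair/= -natrD; congr (_%:R); rewrite inordK//; lia.
have -> : (nu \x M m) (\big[setU/set0]_(j < n.+1) F j) =
   (nu \x M m) (\big[setU/set0]_(j < n.+1) F j) +
   ((nu \x M m) ((~` nat_points) `*` setT) + (nu \x M m) (setT `*` neg_itv)).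
  have -> : (nu \x M m) ((~` nat_points) `*` setT) = 0.
    have := product_measure1E nu (M m) mN measurableT.
    by rewrite [X in X * _](_ : _ = 0) ?mul0e//; exact: root_nat.
  have -> : (nu \x M m) (setT `*` neg_itv) = 0.
    have := product_measure1E nu (M m) measurableT (measurable_itv `]-oo, 0%R[).
    by rewrite [X in _ * X](_ : _ = 0) ?mule0//; exact: power_neg_null.
  by rewrite !adde0.
apply: (@le_trans _ _ ((nu \x M m) ((\big[setU/set0]_(j < n.+1) F j) `|`
   (((~` nat_points) `*` setT) `|` (setT `*` neg_itv))))).
  apply: le_measure; rewrite ?inE//.
    by apply: measurableU => //; apply: measurableU; apply: measurableX => //; exact: measurable_itv.
  move=> [x y] /= xy; have [[j _ jx]|xn] := pselect (nat_points x); last by right; left.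
  have [jn|nj] := leqP j n; last first.
    right; right; split => //=; rewrite /neg_itv/= in_itv/=.
    move: xy; rewrite /addpair/= -jx => /eqP; rewrite -subr_eq0 => /eqP h.
    have : (n%:R < j%:R :> R)%R by rewrite ltr_nat.
    lra.
  left; rewrite -bigcup_mkord_ord; exists j; first by rewrite /= ltnS.
  rewrite /F; split => /=; first by rewrite inordK.
  by move: xy; rewrite /addpair/= -jx inordK// natrB// => <-; rewrite addrAC subrr add0r.
apply: le_trans (measureU2 _ _ _) _ => //.
  by apply: measurableU; apply: measurableX => //; exact: measurable_itv.
by rewrite leeD2l//; apply: measureU2; apply: measurableX => //; exact: measurable_itv.
Qed.

End NatSupport.

(** * The logarithmic derivative of an infinitely divisible sequence *)

Section ConvolutionRoots.
Context {R : realType}.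
Implicit Types (b p r : nat -> R).

(** The coefficients of the N-th power of the power series with coefficients b (see
    [coef_cpow]). *)
Fixpoint cpow b (N n : nat) : R :=
  if N is N'.+1 then \sum_(j < n.+1) b j * cpow b N' (n - j) else (n == 0)%:R.

Lemma conv_prob_power_nat (mu nu : probability R R) N :
  mu (~` nat_points) = 0%E -> (0 < mu [set 0%R])%E ->
  (forall A, measurable A -> mu A = conv_prob_power nu N.+1 A) ->
  forall m n, conv_prob_power nu m [set n%:R] =
    (cpow (fun j => fine (nu [set j%:R])) m n)%:E.
Proof.
move=> mu_nat mu0 muE; elim=> [|m ih] n.
  rewrite /= diracE; congr (_%:R)%:E.
  have [->|n0] := eqVneq n 0%N; first by rewrite mem_set.
  by rewrite memNset//= => /esym/eqP; rewrite pnatr_eq0 (negbTE n0).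
rewrite [LHS](conv_prob_nat mu_nat mu0 muE) -sumEFin; apply: eq_bigr => j _.
rewrite [X in (_ * X)%E]ih EFinM fineK//.
by apply: fin_num_measure; exact: measurable_set1.
Qed.

Lemma infinitely_divisible_cpow (mu : probability R R) N :
  mu (~` nat_points) = 0%E -> (0 < mu [set 0%R])%E -> infinitely_divisible mu ->
  exists b, (forall j, 0 <= b j <= 1) /\
    forall n, fine (mu [set n%:R]) = cpow b N.+1 n.
Proof.
move=> mu_nat mu0 /(_ N.+1 isT)[nu muE].
have muE' A : measurable A -> mu A = conv_prob_power nu N.+1 A.
  by move=> mA; rewrite muE// convolution_powerE.
exists (fun j => fine (nu [set j%:R])); split => [j|n].
  rewrite fine_ge0//= -lee_fin fineK; first by apply: probability_le1; exact: measurable_set1.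
  by apply: fin_num_measure; exact: measurable_set1.
rewrite muE'; last exact: measurable_set1.
by rewrite (conv_prob_power_nat mu_nat mu0 muE').
Qed.

(** The list of the first n values, since the recursion for the next one uses them all. *)
Fixpoint log_deriv_list p (n : nat) : seq R :=
  if n is m.+1 then
    let s := log_deriv_list p m in
    rcons s ((m.+1%:R * p m.+1 - \sum_(j < m) s`_j * p (m - j)%N) / p 0%N)
  else [::].

(** The coefficients of G'/G for G = sum_n p_n u^n, by the recursion [log_derivE].  For the
    law of a compound Poisson variable they are the jump rates of size n + 1 times n + 1. *)
Definition log_deriv p n : R := (log_deriv_list p n.+1)`_n.

Lemma size_log_deriv_list p n : size (log_deriv_list p n) = n.
Proof. by elim: n => //= n ih; rewrite size_rcons ih. Qed.

Lemma nth_log_deriv_list p n j : (j < n)%N -> (log_deriv_list p n)`_j = log_deriv p j.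
Proof.
elim: n => // n ih; rewrite ltnS leq_eqVlt => /predU1P[-> //|jn].
by rewrite /= nth_rcons size_log_deriv_list jn ih.
Qed.

Lemma log_derivE p n : p 0%N != 0 ->
  n.+1%:R * p n.+1 = \sum_(j < n.+1) log_deriv p j * p (n - j)%N.
Proof.
move=> p0.
have E : log_deriv p n * p 0%N = n.+1%:R * p n.+1 - \sum_(j < n) log_deriv p j * p (n - j)%N.
  rewrite {1}/log_deriv/= nth_rcons size_log_deriv_list ltnn eqxx divfK//.
  by congr (_ - _); apply: eq_bigr => j _; rewrite nth_log_deriv_list.
by rewrite big_ord_recr/= subnn E addrC subrK.
Qed.

Lemma coefM_low (A B C : {poly R}) n i : (forall i, (i <= n)%N -> A`_i = B`_i) ->
  (i <= n)%N -> (A * C)`_i = (B * C)`_i.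
Proof.
move=> AB i_le; rewrite !coefM; apply: eq_bigr => j _.
by rewrite AB//; apply: leq_trans i_le; rewrite -ltnS.
Qed.

(** A series with invertible constant term is invertible modulo X^(n+1). *)
Lemma coefM_eq0_low (C D : {poly R}) n : C`_0 != 0 ->
  (forall i, (i <= n)%N -> (C * D)`_i = 0) -> forall i, (i <= n)%N -> D`_i = 0.
Proof.
move=> C0 CD; elim/ltn_ind => i ih i_le.
have := CD i i_le; rewrite coefM big_ord_recl/= subn0 big1 ?addr0; last first.
  by move=> j _; rewrite ih ?mulr0//; rewrite /bump/=; have := ltn_ord j; lia.
by move/eqP; rewrite mulf_eq0 (negbTE C0) => /eqP.
Qed.

Lemma coef_cpow b N n i : (i < n)%N ->
  ((\poly_(i < n) b i) ^+ N)`_i = cpow b N i.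
Proof.
elim: N i => [|N ih] i i_lt; first by rewrite expr0 coef1.
rewrite exprS coefM/=; apply: eq_bigr => j _.
rewrite ih; last by lia.
by rewrite coef_poly (leq_ltn_trans _ i_lt)// -ltnS.
Qed.

(** If G = B^N then G' B = N G B', so that G'/G = N B'/B.  Truncating the series to polynomials
    leaves the coefficients up to n unchanged. *)
Lemma log_deriv_root p b N : p 0%N != 0 -> (forall n, p n = cpow b N n) ->
  forall n, \sum_(j < n.+1) log_deriv p j * b (n - j)%N = N%:R * (n.+1%:R * b n.+1).
Proof.
move=> p0 pb n.
pose B := \poly_(i < n.+2) b i.
pose C := B ^+ N.
pose L := \poly_(i < n.+1) log_deriv p i.
have CE i : (i < n.+2)%N -> C`_i = p i by move=> i_lt; rewrite coef_cpow// pb.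
have LC i : (i <= n)%N -> (L * C)`_i = (C^`())`_i.
  move=> i_le; rewrite coef_deriv CE; last by rewrite ltnS.
  rewrite -mulr_natl log_derivE// coefM; apply: eq_bigr => j _.
  rewrite coef_poly CE; last by lia.
  by rewrite ifT//; have := ltn_ord j; lia.
have dC : C^`() * B = C * (N%:R *: B^`()).
  rewrite /C deriv_exp -mulr_natl; case: N {pb C CE LC} => [|N]; first by rewrite !mul0r scale0r mulr0.
  by rewrite scaler_nat -[in RHS]mulr_natl exprS /=; ring.
have D0 i : (i <= n)%N -> (C * (L * B - N%:R *: B^`()))`_i = 0.
  move=> i_le; rewrite mulrBr -dC coefB mulrCA mulrA.
  by rewrite (coefM_low (B := C^`()) _ LC)// subrr.
have C0 : C`_0 != 0 by rewrite CE.
have := coefM_eq0_low C0 D0 (leqnn n).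
rewrite coefB coefZ coef_deriv coef_poly ltnS leqnn => /eqP; rewrite subr_eq0 => /eqP.
rewrite [n.+1%:R * _]mulr_natl => <-; rewrite coefM; apply: eq_bigr => j _.
by rewrite !coef_poly ltn_ord ifT//; lia.
Qed.

(** For a root b of order N + 1, [log_deriv_root] and b <= 1 give b_(i+1) <= S / (N + 1) for
    i < n.  In the relation at n, whose right-hand side is non-negative, all terms but
    r_n b_0 are therefore of order 1/(N + 1), while b_0 >= p_0 > 0; letting N grow gives r_n >= 0. *)
Lemma log_deriv_ge0 p : 0 < p 0%N ->
  (forall N, exists b, (forall j, 0 <= b j <= 1) /\ forall n, p n = cpow b N.+1 n) ->
  forall n, 0 <= log_deriv p n.
Proof.
move=> p0 H n; rewrite leNgt; apply/negP => rn.
have p0' : p 0%N != 0 by rewrite gt_eqF.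
pose S := \sum_(j < n) `|log_deriv p j|.
have S0 : 0 <= S by apply: sumr_ge0.
(* Large enough for S^2 / (N + 1) < - r_n p_0, the contradiction below. *)
pose N := Num.truncn (S * S / (- log_deriv p n * p 0%N)).
have [b [b01 pb]] := H N.
have b0 j : 0 <= b j by case/andP: (b01 j).
have b1 j : b j <= 1 by case/andP: (b01 j).
have rel := log_deriv_root p0' pb.
have pb0 : p 0%N <= b 0%N.
  have cb m : cpow b m 0 = b 0%N ^+ m.
    by elim: m => [|m ih] //=; rewrite big_ord1 ih exprS.
  by rewrite pb cb exprS ler_piMr// exprn_ile1.
have small i : (i < n)%N -> N.+1%:R * b i.+1 <= S.
  move=> i_lt; apply: (@le_trans _ _ (N.+1%:R * (i.+1%:R * b i.+1))).
    by rewrite ler_wpM2l// ler_peMl// ler1n.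
  rewrite -rel /S -(big_mkord xpredT (fun j => `|log_deriv p j|)).
  rewrite (@big_cat_nat _ _ _ i.+1)//= big_mkord.
  apply: ler_wpDr; first by apply: sumr_ge0.
  apply: ler_sum => j _; apply: le_trans (ler_norm _) _.
  by rewrite normrM (ger0_norm (b0 _)) ler_piMr.
have low : - (S * S) <= N.+1%:R * (log_deriv p n * b 0%N).
  have := rel n; rewrite big_ord_recr/= subnn => E.
  have {E} -> : log_deriv p n * b 0%N =
     N.+1%:R * (n.+1%:R * b n.+1) - \sum_(j < n) log_deriv p j * b (n - j)%N by rewrite -E; ring.
  rewrite mulrBr lerBrDr -lerBrDl opprK.
  apply: (@le_trans _ _ (S * S)); last by rewrite lerDr !mulr_ge0.
  rewrite /S mulr_suml mulr_sumr; apply: ler_sum => j _.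
  apply: le_trans (ler_norm _) _; rewrite !normrM (ger0_norm (b0 _)) ger0_norm// mulrCA.
  rewrite ler_wpM2l//.
  have -> : (n - j = (n - j.+1).+1)%N by have := ltn_ord j; lia.
  by apply: small; have := ltn_ord j; lia.
have low' : - (S * S) <= N.+1%:R * (log_deriv p n * p 0%N).
  by apply: le_trans low _; rewrite ler_wpM2l// ler_wnM2l// ltW.
have c0 : 0 < - log_deriv p n * p 0%N by rewrite mulr_gt0// oppr_gt0.
have : S * S < N.+1%:R * (- log_deriv p n * p 0%N).
  by rewrite -ltr_pdivrMr//; exact: truncnS_gt.
by lra.
Qed.

End ConvolutionRoots.

(** * Growth of polynomials and of the Mittag-Leffler function *)

Section PolynomialGrowth.
Context {R : realType}.
Implicit Types (p : {poly R}) (u : R).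

Lemma poly_eventually_ge p : p != 0 ->
  exists2 d : R, 0 < d & exists u0 : R, forall u, u0 <= u -> d <= `|p.[u]|.
Proof.
elim/poly_ind: p => [|p c ih]; first by rewrite eqxx.
have [->|/ih[d d0 [u0 H]] _] := eqVneq p 0.
  rewrite mul0r add0r polyC_eq0 => c0; exists `|c|; first by rewrite normr_gt0.
  by exists 0 => u _; rewrite hornerC.
exists d => //; exists (Num.max u0 (Num.max 0 ((d + `|c|) / d))) => u.
rewrite !ge_max => /and3P[u0u u_ge0]; rewrite ler_pdivrMr// => du.
rewrite !hornerE; apply: (@le_trans _ _ (`|p.[u] * u| - `|c|)).
  rewrite lerBrDr normrM (ger0_norm u_ge0) (le_trans du)// mulrC ler_wpM2r//.
  exact: H.
by rewrite -[`|c|]normrN; apply: le_trans (lerB_dist _ _) _; rewrite opprK.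
Qed.

Lemma poly_le_pow p : exists2 B : R, 0 <= B & forall u, 1 <= u -> `|p.[u]| <= B * u ^+ size p.
Proof.
exists (\sum_(i < size p) `|p`_i|); first exact: sumr_ge0.
move=> u u1; rewrite horner_coef mulr_suml.
apply: (le_trans (ler_norm_sum _ _ _)); apply: ler_sum => i _.
have u0 : 0 <= u by lra.
rewrite normrM normrX (ger0_norm u0) ler_wpM2l// ler_weXn2l//.
exact: ltnW.
Qed.

Lemma powR_unbounded (c s C u0 : R) : 0 < c -> 0 < s ->
  ~ (forall u, u0 <= u -> c * u `^ s <= C).
Proof.
move=> c0 s0 H.
pose x := Num.max 1 ((C + 1) / c).
pose u := Num.max u0 (x `^ s^-1).
have x1 : 1 <= x by rewrite le_max lexx.
have x0 : 0 <= x by lra.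
have ux : x <= u `^ s.
  rewrite -{1}(powR_root s0 x0); apply: ge0_ler_powR; rewrite ?nnegrE ?powR_ge0 ?(ltW s0)//.
    by rewrite le_max powR_ge0 orbT.
  by rewrite le_max lexx orbT.
have := H u ltac:(by rewrite le_max lexx).
apply/negP; rewrite -ltNge.
apply: (@lt_le_trans _ _ (c * x)); last by rewrite ler_wpM2l// ltW.
apply: (@lt_le_trans _ _ (C + 1)); first by rewrite ltrDl.
by rewrite mulrC -ler_pdivrMr// le_max lexx orbT.
Qed.

End PolynomialGrowth.

Section MittagLefflerGrowth.
Context {R : realType}.
Variable alpha : R.
Hypothesis alpha01 : 0 < alpha < 1.
Let a0 : 0 < alpha. Proof. by case/andP: alpha01. Qed.
Local Notation E := (psum (ml_coef alpha)).

(** The n-th term of E(v^alpha) is 2^(- alpha n) times that of E((2 v)^alpha), which is at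
    most exp(2 v) by [ml_coef_term]; the geometric series converges. *)
Lemma ml_upper : exists2 C : R, 0 < C & forall v, 0 <= v -> E (v `^ alpha) <= C * expR (2 * v).
Proof.
pose q : R := (2 `^ alpha)^-1.
have q0 : 0 < q by rewrite invr_gt0 powR_gt0.
have q1 : q < 1.
  rewrite invf_lt1 ?powR_gt0// /powR pnatr_eq0/= expR_gt1.
  by rewrite mulr_gt0// ln_gt0// ltr1n.
exists (1 - q)^-1; first by rewrite invr_gt0; lra.
move=> v v0.
have nq : `|q| < 1 by rewrite ger0_norm// ltW.
have cvg_geo := @cvg_geometric_series _ (expR (2 * v)) q nq.
rewrite mulrC -(cvg_lim _ cvg_geo)//; apply: lim_series_le.
- exact: (ml_entire a0).
- by apply/cvg_ex; eexists; exact: cvg_geo.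
- move=> n; rewrite /geometric/= /q exprVn ler_pdivlMr ?exprn_gt0 ?powR_gt0//.
  rewrite -mulrA -exprMn [v `^ _ * _]mulrC -powRM//.
  by apply: ml_coef_term => //; rewrite mulr_ge0.
Qed.

(** Some index n satisfies q <= alpha n <= q + 1, because alpha < 1; the term at n alone
    gives v^q / (q! (q + 2)) <= E(v^alpha).  The exponential series of v / 4 leaves a
    factor 4^(-q), enough to absorb q + 2 and to sum over q. *)
Lemma ml_lower v : 1 <= v -> expR (v / 4) <= 4 * E (v `^ alpha).
Proof.
move=> v1; have v0 : 0 <= v by lra.
have E0 : 0 <= E (v `^ alpha).
  apply: le_trans (term_le_psum 0 (powR_ge0 _ _) (ml_entire a0) (fun n => ltW (ml_coef_gt0 a0 n))).
  by rewrite expr0 mulr1 ltW// ml_coef_gt0.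
have term q : v ^+ q / (q`!%:R * q.+2%:R) <= E (v `^ alpha).
  have qa0 : 0 <= q%:R / alpha by rewrite divr_ge0// ltW.
  (* The least n with q < alpha n. *)
  pose n := (Num.truncn (q%:R / alpha)).+1.
  have n1 : q%:R <= alpha * n%:R.
    by rewrite mulrC -ler_pdivrMr//; apply/ltW/truncnS_gt.
  have n2 : alpha * n%:R <= q.+1%:R.
    have h : n%:R <= q%:R / alpha + 1.
      by rewrite -natr1 lerD2r; case/andP: (truncn_itv qa0).
    have : alpha * n%:R <= alpha * (q%:R / alpha + 1) by rewrite ler_wpM2l// ltW.
    rewrite mulrDr mulr1 mulrCA divff ?gt_eqF// mulr1 => h2; apply: (le_trans h2).
    by rewrite -natr1 lerD2l; case/andP: alpha01 => _ /ltW.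
  apply: le_trans (term_le_psum n (powR_ge0 _ _) (ml_entire a0) (fun n => ltW (ml_coef_gt0 a0 n))).
  rewrite mulrC -powR_natM; apply: ler_pM.
  - by rewrite invr_ge0 mulr_ge0.
  - exact: exprn_ge0.
  - rewrite /ml_coef lef_pV2 ?posrE ?mulr_gt0 ?ltr0n ?fact_gt0//.
      by apply: Gamma_le_itv; rewrite n1 n2.
    by rewrite Gamma_gt0// ltr_wpDl// mulr_ge0// ltW.
  - by rewrite -powR_mulrn//; exact: ler_powR.
have nq : `|2^-1 : R| < 1 by rewrite ger0_norm//; lra.
have cvg_geo := @cvg_geometric_series _ (2 * E (v `^ alpha)) 2^-1 nq.
have -> : 4 * E (v `^ alpha) = 2 * E (v `^ alpha) / (1 - 2^-1) by field.
rewrite -(cvg_lim _ cvg_geo)//; apply: lim_series_le.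
- exact: is_cvg_series_exp_coeff.
- by apply/cvg_ex; eexists; exact: cvg_geo.
- move=> q; rewrite /geometric/= /exp_coeff/=.
  have fq : 0 < q`!%:R :> R by rewrite ltr0n fact_gt0.
  rewrite ler_pdivrMr// expr_div_n exprVn.
  have := term q; rewrite ler_pdivrMr; last by rewrite mulr_gt0.
  move=> h; rewrite ler_pdivrMr ?exprn_gt0//; apply: (le_trans h).
  rewrite (_ : 4 ^+ q = 2 ^+ q * 2 ^+ q :> R); last by rewrite -exprMn -natrM.
  have : q.+2%:R <= 2 * 2 ^+ q :> R.
    by rewrite -exprS -natrX ler_nat; exact: ltn_expl.
  have h2 : 2 ^+ q != 0 :> R by rewrite expf_eq0 pnatr_eq0 andbF.
  rewrite (_ : 2 * E (v `^ alpha) / 2 ^+ q * q`!%:R * (2 ^+ q * 2 ^+ q) =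
    E (v `^ alpha) * (q`!%:R * (2 * 2 ^+ q))); last by field.
  by move=> h3; rewrite ler_wpM2l// ler_wpM2l// ltW.
Qed.

End MittagLefflerGrowth.

(** * Series with a non-negative logarithmic derivative *)

Section LogDerivative.
Context {R : realType}.
Variables (p r : R ^nat).
Hypothesis p_entire : entire p.
Hypothesis p_ge0 : forall n, 0 <= p n.
Hypothesis r_ge0 : forall n, 0 <= r n.
Hypothesis pr : forall n, n.+1%:R * p n.+1 = \sum_(j < n.+1) r j * p (n - j)%N.
Local Notation G := (psum p).
Local Notation G' := (psum (pseries_diffs p)).

Lemma psum_iter_shift j u :
  entire (iter j (@pshift R) p) /\ psum (iter j (@pshift R) p) u = u ^+ j * G u.
Proof.
elim: j => [|j [ej sj]]; first by rewrite expr0 mul1r.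
rewrite iterS; split; first exact: entire_shift.
by rewrite psum_shift// sj mulrA -exprS.
Qed.

Lemma iter_pshiftE j n : iter j (@pshift R) p n = if (j <= n)%N then p (n - j)%N else 0.
Proof. by elim: j n => [|j ih] [|n] //=; rewrite ih subSS. Qed.

(** Only the index j is kept in the recursion for p, all of whose terms are non-negative. *)
Lemma psum_deriv_ge j u : 0 <= u -> r j * u ^+ j * G u <= G' u.
Proof.
move=> u0; have [ej sj] := psum_iter_shift j u.
rewrite -mulrA -sj -psumZ//; apply: psum_le => //; first exact: entireZ.
  exact: entire_diffs.
move=> n; rewrite /pseries_diffs pr iter_pshiftE.
case: ifPn => [jn|_]; last by rewrite mulr0 sumr_ge0// => i _; rewrite mulr_ge0.
rewrite (bigD1 (Ordinal (jn : j < n.+1)%N))//= lerDl.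
by apply: sumr_ge0 => i _; rewrite mulr_ge0.
Qed.

(** G' = (G'/G) G, when the coefficients of G'/G vanish from D on. *)
Lemma psum_derivE D u : (forall j, (D <= j)%N -> r j = 0) ->
  G' u = (\poly_(i < D) r i).[u] * G u.
Proof.
move=> r0.
have [ed sd] : entire (fun n => \sum_(j < D) r j * iter j (@pshift R) p n) /\
    psum (fun n => \sum_(j < D) r j * iter j (@pshift R) p n) u =
    \sum_(j < D) r j * (u ^+ j * G u).
  elim: D {r0} => [|D [ed sd]].
    have h : (fun n => \sum_(j < 0) r j * iter j (@pshift R) p n) = fun=> 0.
      by apply/funext => n; rewrite big_ord0.
    have [e s] := @psum_finite _ (fun=> 0 : R) 0 u (fun _ _ => erefl).
    by rewrite h; split => //; rewrite s !big_ord0.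
  have [ej sj] := psum_iter_shift D u.
  have -> : (fun n => \sum_(j < D.+1) r j * iter j (@pshift R) p n) =
     (fun n => (\sum_(j < D) r j * iter j (@pshift R) p n) + r D * iter D (@pshift R) p n).
    by apply/funext => n; rewrite big_ord_recr.
  split; first by apply: entireD => //; exact: entireZ.
  by rewrite psumD//; [rewrite psumZ// sd sj big_ord_recr|exact: entireZ].
rewrite horner_poly mulr_suml.
transitivity (\sum_(j < D) r j * (u ^+ j * G u)); last by apply: eq_bigr => j _; rewrite mulrA.
rewrite -sd; congr psum; apply/funext => n; rewrite /pseries_diffs pr.
under [RHS]eq_bigr do rewrite iter_pshiftE.
pose f j := if (j <= n)%N then r j * p (n - j)%N else 0.
transitivity (\sum_(j < maxn D n.+1) f j).
  rewrite -(big_mkord xpredT f) (@big_cat_nat _ _ _ n.+1)//= ?leq_maxr//.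
  rewrite [X in _ + X]big_nat_cond [X in _ + X]big1 ?addr0; last first.
    by move=> i /andP[/andP[ni _] _]; rewrite /f leqNgt ni.
  by rewrite big_mkord; apply: eq_bigr => j _; rewrite /f -ltnS ltn_ord.
rewrite -(big_mkord xpredT f) (@big_cat_nat _ _ _ D)//= ?leq_maxl//.
rewrite [X in _ + X]big_nat_cond [X in _ + X]big1 ?addr0; last first.
  by move=> i /andP[/andP[Di _] _]; rewrite /f r0// mul0r; case: ifP.
by rewrite big_mkord; apply: eq_bigr => j _; rewrite /f; case: ifP => _; rewrite ?mulr0.
Qed.

Lemma is_derive_psum_exp (H : {poly R}) (u : R) :
  is_derive u 1 (fun x => G x * expR (- H.[x]))
    ((G' u - H^`().[u] * G u) * expR (- H.[u])).
Proof.
have dG := psum_derive u p_entire.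
have dH : is_derive u 1 (fun x => - H.[x]) (- H^`().[u]).
  by apply: is_deriveN; exact: is_derive_horner.
have dE := @is_derive1_comp _ expR (fun x => - H.[x]) u _ _ (is_derive_expR (- H.[u])) dH.
apply: (is_derive_eq (is_deriveM dG dE)).
rewrite -![_ *: _]/(_ * _) /=; ring.
Qed.

(** G exp(- H) is non-decreasing. *)
Lemma psum_ge_exp (H : {poly R}) u : H.[0] = 0 ->
  (forall x, 0 <= x -> H^`().[x] * G x <= G' x) -> 0 <= u ->
  p 0%N * expR H.[u] <= G u.
Proof.
move=> H0 HG u0.
suff : G 0 * expR (- H.[0]) <= G u * expR (- H.[u]).
  by rewrite psum0 H0 oppr0 expR0 mulr1 expRN ler_pdivlMr ?expR_gt0.
apply: (@ger0_derive1_ndecr _ (fun x => G x * expR (- H.[x])) 0 u) => //.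
- by move=> x _; have [] := is_derive_psum_exp H x.
- move=> x; rewrite in_itv/= => /andP[x0 _].
  have d := is_derive_psum_exp H x.
  by rewrite derive1E derive_val mulr_ge0 ?expR_ge0// subr_ge0 HG// ltW.
- apply: derivable_within_continuous => x _.
  by have [] := is_derive_psum_exp H x.
Qed.

(** G exp(- H) is constant. *)
Lemma psum_eq_exp (H : {poly R}) u : H.[0] = 0 ->
  (forall x, G' x = H^`().[x] * G x) -> G u = p 0%N * expR H.[u].
Proof.
move=> H0 HG.
suff : G 0 * expR (- H.[0]) = G u * expR (- H.[u]).
  rewrite psum0 H0 oppr0 expR0 mulr1 => ->.
  by rewrite -mulrA -expRD addNr expR0 mulr1.
apply: (@is_derive_0_is_cst _ (fun x => G x * expR (- H.[x]))) => x.
have := is_derive_psum_exp H x.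
by rewrite HG subrr mul0r.
Qed.

End LogDerivative.

(** * The exponent equation *)

Section JumpPolynomial.
Context {R : realType} (k : nat) (lam : 'I_k.+1 -> R).
Hypothesis lam0 : forall j, 0 < lam j.
Local Notation w := (jump_poly lam).
Let L := \sum_(j < k.+1) lam j.
Let L0 : 0 <= L. Proof. by apply: sumr_ge0 => j _; exact: ltW. Qed.

Lemma horner_jump_poly u : w.[u] = \sum_(j < k.+1) lam j * u ^+ j.+1 - L.
Proof.
rewrite /jump_poly hornerD hornerN hornerC horner_sum; congr (_ - _).
by apply: eq_bigr => j _; rewrite hornerZ hornerXn.
Qed.

Lemma jump_poly_le u : 1 <= u -> w.[u] <= L * u ^+ k.+1.
Proof.
move=> u1; rewrite horner_jump_poly; apply: (@le_trans _ _ (\sum_(j < k.+1) lam j * u ^+ j.+1)).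
  by rewrite lerBlDr lerDl.
rewrite /L mulr_suml; apply: ler_sum => j _.
by rewrite ler_wpM2l ?ler_weXn2l// ltW.
Qed.

Lemma jump_poly_ge : exists2 c : R, 0 < c &
  exists u0 : R, forall u, u0 <= u -> c * u ^+ k.+1 <= w.[u].
Proof.
pose l := lam ord_max; have l0 : 0 < l := lam0 ord_max.
exists (l / 2); first by rewrite divr_gt0.
exists (Num.max 1 (L / (l / 2))) => u; rewrite ge_max => /andP[u1].
rewrite ler_pdivrMr ?divr_gt0// => uL.
have uk : u <= u ^+ k.+1 by rewrite -{1}(expr1 u) ler_weXn2l.
have : L <= l / 2 * u ^+ k.+1.
  by apply: (le_trans uL); rewrite mulrC ler_wpM2l// ltW// divr_gt0.
rewrite horner_jump_poly big_ord_recr/= -/l => h.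
have : 0 <= \sum_(i < k) lam (widen_ord (leqnSn k) i) * u ^+ i.+1.
  by apply: sumr_ge0 => i _; rewrite mulr_ge0 ?exprn_ge0 ?(ltW (lam0 _))//; lra.
lra.
Qed.

Lemma jump_poly_unbounded (B : R) : exists u0 : R, forall u, u0 <= u -> B <= w.[u].
Proof.
have [c c0 [u0 H]] := jump_poly_ge.
exists (Num.max u0 (Num.max 1 (B / c))) => u; rewrite !ge_max => /and3P[uu0 u1].
rewrite ler_pdivrMr// => h; apply: le_trans (H u uu0).
apply: (le_trans h); rewrite mulrC ler_wpM2l// ?(ltW c0)//.
by rewrite -{1}(expr1 u) ler_weXn2l.
Qed.

Lemma deriv_jump_poly_neq0 : w^`() != 0.
Proof.
apply/negP => /eqP w'0.
have w1 : w`_1 = lam ord0.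
  rewrite /jump_poly coefB coefC subr0 coef_sum (bigD1 ord0)//= coefZ coefXn eqxx mulr1.
  rewrite big1 ?addr0// => j j0; rewrite coefZ coefXn eqSS.
  by rewrite (_ : (0 == j)%N = false) ?mulr0//; apply/negbTE; rewrite eq_sym.
have := coef_deriv w 0; rewrite w'0 coef0 w1 mulr1n => h.
by have := lam0 ord0; rewrite -h ltxx.
Qed.

End JumpPolynomial.

Section ExponentEquation.
Context {R : realType}.
Variables (alpha tau : R) (k : nat) (lam : 'I_k.+1 -> R).
Hypothesis alpha01 : 0 < alpha < 1.
Hypothesis tau0 : 0 < tau.
Hypothesis lam0 : forall j, 0 < lam j.
Let a0 : 0 < alpha. Proof. by case/andP: alpha01. Qed.
Local Notation w := (jump_poly lam).
Local Notation E := (psum (ml_coef alpha)).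
Let L := \sum_(j < k.+1) lam j.
Let L0 : 0 <= L. Proof. by apply: sumr_ge0 => j _; exact: ltW. Qed.

Variables (p r : R ^nat).
Hypothesis p_entire : entire p.
Hypothesis p_ge0 : forall n, 0 <= p n.
Hypothesis p0_gt0 : 0 < p 0%N.
Hypothesis r_ge0 : forall n, 0 <= r n.
Hypothesis pr : forall n, n.+1%:R * p n.+1 = \sum_(j < n.+1) r j * p (n - j)%N.
Hypothesis pE : forall u, psum p u = E (tau * w.[u]).
Local Notation G := (psum p).

Let K1 : R := tau * L.

(** If r_j > 0 then G u >= p_0 exp(c u^(j+1)) by [psum_ge_exp]; but [ml_upper] at
    v = (tau w(u))^(1/alpha) gives G u <= C exp(2 v), where v^alpha = O(u^(k+1)).
    Together, u^(alpha (j + 1)) = O(u^(k+1)). *)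
Lemma log_deriv_eq0 j : k.+1%:R < alpha * j.+1%:R -> r j = 0.
Proof.
move=> kj; apply/eqP; rewrite eq_le r_ge0 andbT leNgt; apply/negP => rj.
pose H : {poly R} := (r j / j.+1%:R) *: 'X^(j.+1).
have H0 : H.[0] = 0 by rewrite /H hornerZ hornerXn expr0n/= mulr0.
have HG x : 0 <= x -> H^`().[x] * G x <= psum (pseries_diffs p) x.
  move=> x0; rewrite /H derivZ derivXn/= hornerZ hornerMn hornerXn.
  rewrite -[x ^+ j *+ _]mulr_natl [_ * (_ * x ^+ j)]mulrA divfK ?pnatr_eq0//.
  exact: psum_deriv_ge.
have low u : 0 <= u -> p 0%N * expR (r j / j.+1%:R * u ^+ j.+1) <= G u.
  move=> u0; have := psum_ge_exp p_entire H0 HG u0.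
  by rewrite /H hornerZ hornerXn.
have [C C0 up] := ml_upper alpha01.
pose rho := r j / j.+1%:R; have rho0 : 0 < rho by rewrite divr_gt0.
have [u0 wpos] := jump_poly_unbounded lam0 0.
pose u1 := Num.max (Num.max 1 u0) (ln (C / p 0%N) / (rho / 2)).
pose s := alpha * j.+1%:R - k.+1%:R.
apply: (@powR_unbounded R ((rho / 4) `^ alpha) s K1 u1).
- by rewrite powR_gt0// divr_gt0.
- by rewrite /s subr_gt0.
move=> u; rewrite !ge_max => /andP[/andP[ug1 uu0]].
rewrite ler_pdivrMr ?divr_gt0// => hC.
have ugt0 : 0 < u by lra.
have tw0 : 0 <= tau * w.[u] by rewrite mulr_ge0 ?wpos// ltW.
pose v := (tau * w.[u]) `^ alpha^-1.
have vE : v `^ alpha = tau * w.[u] by exact: powR_root.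
have v0 : 0 <= v by exact: powR_ge0.
have h1 : p 0%N * expR (rho * u ^+ j.+1) <= C * expR (2 * v).
  by apply: le_trans (low u (ltW ugt0)) _; rewrite pE -vE up.
have h2 : rho * u ^+ j.+1 <= ln (C / p 0%N) + 2 * v.
  rewrite -ler_expR expRD lnK ?posrE ?divr_gt0// [leRHS]mulrAC ler_pdivlMr//.
  by rewrite mulrC.
have uj : u <= u ^+ j.+1 by rewrite -{1}(expr1 u) ler_weXn2l.
have h3 : rho / 4 * u ^+ j.+1 <= v.
  have : ln (C / p 0%N) <= rho / 2 * u ^+ j.+1.
    by apply: (le_trans hC); rewrite mulrC ler_wpM2l// ltW// divr_gt0.
  lra.
have h4 : (rho / 4) `^ alpha * u `^ (alpha * j.+1%:R) <= K1 * u ^+ k.+1.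
  rewrite mulrC powRrM.
  have -> : (u `^ alpha) `^ j.+1%:R = (u ^+ j.+1) `^ alpha.
    by rewrite -powRrM mulrC powRrM powR_mulrn// ltW.
  rewrite mulrC -powRM ?exprn_ge0 ?(ltW ugt0)//; last by rewrite divr_ge0// ltW.
  apply: (@le_trans _ _ (v `^ alpha)).
    apply: ge0_ler_powR; rewrite ?nnegrE ?(ltW a0)//.
    by rewrite mulr_ge0 ?exprn_ge0 ?(ltW ugt0)// divr_ge0// ltW.
  by rewrite vE /K1 -mulrA ler_wpM2l ?(ltW tau0)// jump_poly_le.
have uk0 : 0 < u ^+ k.+1 by exact: exprn_gt0.
rewrite -(ler_pM2r uk0) -mulrA; apply: le_trans h4; rewrite le_eqVlt; apply/orP; left.
rewrite -powR_mulrn ?(ltW ugt0)// -powRD; last by rewrite (gt_eqF ugt0) implybT.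
by rewrite /s subrK.
Qed.

Let D := Num.truncn (k.+1%:R / alpha).

Let D_le : alpha * D%:R <= k.+1%:R.
Proof.
rewrite mulrC -ler_pdivlMr//; have /truncn_itv : 0 <= k.+1%:R / alpha by rewrite divr_ge0// ltW.
by case/andP.
Qed.

Let r_eq0 j : (D <= j)%N -> r j = 0.
Proof.
move=> Dj; apply: log_deriv_eq0; rewrite mulrC -ltr_pdivrMr//.
by apply: (lt_le_trans (truncnS_gt _)); rewrite ler_nat ltnS.
Qed.

Let Rp : {poly R} := \poly_(i < D) r i.
Let H : {poly R} := \sum_(i < D) (r i / i.+1%:R) *: 'X^(i.+1).

Let dH : H^`() = Rp.
Proof.
rewrite /H raddf_sum /Rp poly_def; apply: eq_bigr => i _.
by rewrite [LHS]derivZ derivXn/= -['X^i *+ _]scaler_nat scalerA divfK// pnatr_eq0.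
Qed.

Let H0 : H.[0] = 0.
Proof. by rewrite /H horner_sum big1// => i _; rewrite hornerZ hornerXn expr0n mulr0. Qed.

Lemma psum_deriv u : psum (pseries_diffs p) u = Rp.[u] * G u.
Proof. by apply: (psum_derivE (r := r)) => // j; exact: r_eq0. Qed.

Lemma psum_expH u : G u = p 0%N * expR H.[u].
Proof. by apply: psum_eq_exp => // x; rewrite dH psum_deriv. Qed.

(** G = p_0 exp(H) with H of degree at most D, while [ml_lower] at v = (tau w(u))^(1/alpha)
    gives exp(v / 4) <= 4 G u, where v^alpha is at least a multiple of u^(k+1).
    Hence u^(k+1) = O(u^(alpha D)) and k + 1 <= alpha D; the converse holds by the choice of D. *)
Lemma exponent_eq : alpha * D%:R = k.+1%:R.
Proof.
apply/eqP; rewrite eq_le D_le/= leNgt; apply/negP => Dk.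
pose h := \sum_(i < D) r i / i.+1%:R.
have h0 : 0 <= h by apply: sumr_ge0 => i _; rewrite divr_ge0.
have Hle u : 1 <= u -> H.[u] <= h * u ^+ D.
  move=> u1; rewrite /H horner_sum /h mulr_suml; apply: ler_sum => i _.
  rewrite hornerZ hornerXn ler_wpM2l ?divr_ge0// ler_weXn2l//.
have [c c0 [u0 wge]] := jump_poly_ge lam0.
have [u1 wge1] := jump_poly_unbounded lam0 (tau^-1).
(* Absorbs both ln (4 p_0) and H, so that v <= h' u^D. *)
pose h' := 4 * (`|ln (4 * p 0%N)| + h).
pose s := k.+1%:R - alpha * D%:R.
apply: (@powR_unbounded R (tau * c) s (h' `^ alpha) (Num.max 1 (Num.max u0 u1))).
- by rewrite mulr_gt0.
- by rewrite subr_gt0.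
move=> u; rewrite !ge_max => /and3P[ug1 uu0 uu1].
have ugt0 : 0 < u by lra.
have tw1 : 1 <= tau * w.[u].
  by have := ler_wpM2l (ltW tau0) (wge1 u uu1); rewrite mulfV// gt_eqF.
have tw0 : 0 <= tau * w.[u] by lra.
pose v := (tau * w.[u]) `^ alpha^-1.
have vE : v `^ alpha = tau * w.[u] by exact: powR_root.
have v1 : 1 <= v.
  have -> : 1 = 1 `^ alpha^-1 :> R by rewrite powR1.
  by apply: ge0_ler_powR; rewrite ?nnegrE ?invr_ge0 ?(ltW a0).
have h1 : expR (v / 4) <= 4 * (p 0%N * expR H.[u]).
  by apply: (le_trans (ml_lower alpha01 v1)); rewrite vE -pE psum_expH.
have h2 : v / 4 <= ln (4 * p 0%N) + H.[u].
  by rewrite -ler_expR expRD lnK ?posrE ?mulr_gt0// -mulrA.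
have uD : 1 <= u ^+ D by exact: exprn_ege1.
have h3 : v <= h' * u ^+ D.
  have : ln (4 * p 0%N) <= `|ln (4 * p 0%N)| * u ^+ D.
    by apply: le_trans (ler_norm _) _; rewrite ler_peMr.
  have := Hle u ug1; rewrite [h' * _](_ : _ = 4 * (`|ln (4 * p 0%N)| * u ^+ D + h * u ^+ D)).
    by move: h2; lra.
  by rewrite /h'; ring.
have h4 : tau * c * u ^+ k.+1 <= h' `^ alpha * u `^ (alpha * D%:R).
  have h'0 : 0 <= h' by rewrite mulr_ge0// addr_ge0.
  have -> : u `^ (alpha * D%:R) = (u ^+ D) `^ alpha.
    by rewrite mulrC powRrM powR_mulrn// ltW.
  rewrite -powRM ?exprn_ge0 ?(ltW ugt0)//.
  apply: (@le_trans _ _ (v `^ alpha)).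
    by rewrite vE -mulrA ler_wpM2l ?(ltW tau0)// wge.
  apply: ge0_ler_powR; rewrite ?nnegrE ?(ltW a0) ?powR_ge0//.
  by rewrite mulr_ge0 ?exprn_ge0 ?(ltW ugt0).
have ua0 : 0 < u `^ (alpha * D%:R) by rewrite powR_gt0.
rewrite -(ler_pM2r ua0); apply: le_trans h4.
rewrite -[leLHS]mulrA -powRD; last by rewrite (gt_eqF ugt0) implybT.
by rewrite /s subrK powR_mulrn// ltW.
Qed.

End ExponentEquation.

(** * Euler operators on the Mittag-Leffler series *)

Section FallingCoefficients.
Context {R : realType}.
Variable alpha : R.
Hypothesis alpha01 : 0 < alpha < 1.
Let a0 : 0 < alpha. Proof. by case/andP: alpha01. Qed.

(** The coefficients of prod_(l < i) (alpha x d/dx - l) applied to the Mittag-Leffler function: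
    on x^n the operator acts as the scalar prod_(l < i) (alpha n - l). *)
Fixpoint euler_coef (i n : nat) : R :=
  if i is i'.+1 then (alpha * n%:R - i'%:R) * euler_coef i' n else ml_coef alpha n.

Local Notation E := (psum (ml_coef alpha)).
Local Notation K i := (psum (euler_coef i)).
Local Notation K' i := (psum (pseries_diffs (euler_coef i))).

Lemma euler_coefS i : euler_coef i.+1 =
  fun n => alpha * (n%:R * euler_coef i n) + (- i%:R) * euler_coef i n.
Proof. by apply/funext => n /=; ring. Qed.

Lemma euler_entire i : entire (euler_coef i).
Proof.
elim: i => [|i ih]; first exact: ml_entire.
by rewrite euler_coefS; apply: entireD; apply: entireZ => //; exact: entire_natM.
Qed.

Lemma eulerS i x : K i.+1 x = alpha * (x * K' i x) - i%:R * K i x.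
Proof.
have e : entire (euler_coef i) by exact: euler_entire.
have en := entire_natM e.
rewrite euler_coefS psumD; [|exact: entireZ|exact: entireZ].
by rewrite !psumZ// psum_natM// mulNr.
Qed.

Lemma Gamma_falling i (a : R) : i%:R <= a ->
  Gamma (a + 1) = (\prod_(l < i) (a - l%:R)) * Gamma (a - i%:R + 1).
Proof.
elim: i => [|i ih] ia; first by rewrite big_ord0 mul1r subr0.
have ia' : i%:R < a by apply: lt_le_trans ia; rewrite ltr_nat.
rewrite ih; last exact: ltW.
rewrite (_ : a - i.+1%:R + 1 = a - i%:R); last by rewrite -natr1; ring.
have -> : Gamma (a - i%:R + 1) = (a - i%:R) * Gamma (a - i%:R) by apply: GammaS; rewrite subr_gt0.
by rewrite big_ord_recr/= -mulrA.
Qed.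

Lemma euler_coefE i n : euler_coef i n = (\prod_(l < i) (alpha * n%:R - l%:R)) * ml_coef alpha n.
Proof.
elim: i => [|i ih]; first by rewrite big_ord0 mul1r.
by rewrite /= ih big_ord_recr/=; ring.
Qed.

Lemma euler_coef1_neq0 i : euler_coef i 1 != 0.
Proof.
rewrite euler_coefE mulf_neq0 ?(gt_eqF (ml_coef_gt0 a0 _))//.
apply/prodf_neq0 => l _; rewrite mulr1 subr_eq0.
case/andP: alpha01 => h0 h1.
case: l => -[|l] /= _; first by rewrite gt_eqF.
by rewrite lt_eqF// (lt_le_trans h1)// ler1n.
Qed.

Variables (k m : nat).
Hypothesis km : alpha * m%:R = k%:R.

(** Since alpha (n - m) = alpha n - k, the product of the alpha n - l cancels against k steps of
    the functional equation of Gamma. *)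
Lemma euler_coef_shift n : (m <= n)%N -> euler_coef k n = ml_coef alpha (n - m).
Proof.
move=> mn; rewrite euler_coefE /ml_coef natrB// mulrBr km.
have kn : k%:R <= alpha * n%:R by rewrite -km ler_wpM2l ?ler_nat// ltW.
have g0 : 0 < Gamma (alpha * n%:R + 1).
  by rewrite Gamma_gt0// ltr_wpDl// mulr_ge0// ltW.
have := Gamma_falling kn; move: g0 => /[swap] E1.
rewrite [in X in X -> _]E1 => g0.
rewrite E1 invfM mulrA divff ?mul1r//.
by apply: contraTneq g0 => ->; rewrite mul0r ltxx.
Qed.

Definition euler_rest : {poly R} := \poly_(n < m) euler_coef k n.

Lemma euler_equation x : K k x = x ^+ m * E x + euler_rest.[x].
Proof.
have [es ss] := psum_iter_shift (ml_entire a0) m x.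
(* The low coefficients, to which the shift relation does not extend. *)
pose c n := if (n < m)%N then euler_coef k n else 0.
have [ec sc] := @psum_finite _ c m x (fun n mn => ltac:(by rewrite /c ltnNge mn)).
have -> : euler_coef k = fun n => iter m (@pshift R) (ml_coef alpha) n + c n.
  apply/funext => n; rewrite iter_pshiftE /c leqNgt; case: ltnP => nm /=; first by rewrite add0r.
  by rewrite addr0 euler_coef_shift.
rewrite psumD// ss sc; congr (_ + _).
by rewrite /euler_rest horner_poly; apply: eq_bigr => i _; rewrite /c ltn_ord.
Qed.

(** The coefficient of x does not vanish, because alpha is not an integer. *)
Lemma euler_rest_neq0 : (1 < m)%N -> euler_rest != 0.
Proof.
move=> m1; apply/negP => /eqP q0.
have := euler_coef1_neq0 k.
have -> : euler_coef k 1 = euler_rest`_1 by rewrite coef_poly m1.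
by rewrite q0 coef0 eqxx.
Qed.

End FallingCoefficients.

(** * Elimination *)

Section EulerElimination.
Context {R : realType}.
Variables (alpha tau : R) (k m : nat) (lam : 'I_k.+1 -> R).
Hypothesis alpha01 : 0 < alpha < 1.
Hypothesis tau0 : 0 < tau.
Hypothesis lam0 : forall j, 0 < lam j.
Hypothesis km : alpha * m%:R = k.+1%:R.
Let a0 : 0 < alpha. Proof. by case/andP: alpha01. Qed.
Local Notation w := (jump_poly lam).
Local Notation w' := (w^`()).
Local Notation E := (psum (ml_coef alpha)).
Local Notation K i := (psum (euler_coef alpha i)).
Local Notation K' i := (psum (pseries_diffs (euler_coef alpha i))).
Variables (G : R -> R) (Rp : {poly R}).
Hypothesis GE : forall u, G u = E (tau * w.[u]).
Hypothesis dG : forall u : R, is_derive u 1 G (Rp.[u] * G u).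

(** The polynomials of [euler_polyE]; the recursion comes from differentiating that identity. *)
Fixpoint euler_poly (i : nat) : {poly R} :=
  if i is i'.+1 then
    alpha *: (w * w' * ((euler_poly i')^`() + euler_poly i' * Rp))
    - i'%:R *: (w' ^+ 2 * euler_poly i')
    - (2 * i'%:R * alpha) *: (w * w'^`() * euler_poly i')
  else 1.

Lemma is_derive_euler i (u : R) :
  is_derive u 1 (fun u => K i (tau * w.[u])) (K' i (tau * w.[u]) * (tau * w'.[u])).
Proof.
have e : entire (euler_coef alpha i) by exact: euler_entire.
have d1 := psum_derive (tau * w.[u]) e.
have d2 : is_derive u 1 (fun u => tau * w.[u]) (tau * w'.[u]).
  have h := is_deriveZ tau (is_derive_poly w u).
  exact: (is_derive_eq h).
exact: (@is_derive1_comp _ (K i) (fun u => tau * w.[u]) u _ _ d1 d2).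
Qed.

(** Induction on i, with x = tau w(u).  By [eulerS] the next function is alpha x K_i'(x) - i K_i(x),
    and differentiating the identity for i gives K_i'(x) tau w', since G' = Rp G.  Multiplying by
    w w' turns tau w' into x w'^2, whence one more factor w'^2 on the left. *)
Lemma euler_polyE i (u : R) :
  (w' ^+ (2 * i)).[u] * K i (tau * w.[u]) = (euler_poly i).[u] * G u.
Proof.
elim: i u => [|i ih] u; first by rewrite muln0 expr0 !hornerC !mul1r GE.
have dl := is_deriveM (is_derive_poly (w' ^+ (2 * i)) u) (is_derive_euler i u).
have dr := is_deriveM (is_derive_poly (euler_poly i) u) (dG u).
have eqd : (horner (w' ^+ (2 * i)) * (fun u => K i (tau * w.[u]))) = (horner (euler_poly i) * G).
  by apply/funext => x; exact: ih.
rewrite eqd in dl.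
have := @derive_val _ _ _ _ _ _ _ dr; rewrite (@derive_val _ _ _ _ _ _ _ dl).
rewrite -![_ *: _]/(_ * _).
have ihu := ih u.
have wW : w'.[u] * ((w' ^+ (2 * i))^`()).[u] = 2 * i%:R * w'^`().[u] * (w' ^+ (2 * i)).[u].
  rewrite deriv_exp hornerMn hornerM !horner_exp -[_ *+ (2 * i)]mulr_natr natrM.
  case: (i) => [|j]; first by rewrite !mulr0 !mul0r.
  have -> : (2 * j.+1)%N = (2 * j).+2 by lia.
  rewrite [(2 * j).+2.-1]/= [_ ^+ (2 * j).+2]exprS.
  by move: (_ ^+ _) => y; ring.
rewrite eulerS//.
have -> : (w' ^+ (2 * i.+1)).[u] = w'.[u] ^+ 2 * (w' ^+ (2 * i)).[u].
  by rewrite mulnS exprD hornerM !horner_exp.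
have -> : (euler_poly i.+1).[u] = alpha * (w.[u] * w'.[u] * ((euler_poly i)^`().[u] + (euler_poly i).[u] * Rp.[u]))
    - i%:R * (w'.[u] ^+ 2 * (euler_poly i).[u])
    - 2 * i%:R * alpha * (w.[u] * w'^`().[u] * (euler_poly i).[u]).
  by rewrite /= !(hornerD, hornerN, hornerZ, hornerM, horner_exp).
move: ihu wW.
move: (w' ^+ (2 * i)).[u] (K i _) (K' i _) ((w' ^+ (2 * i))^`()).[u] => W F F' dW.
move: (euler_poly i).[u] ((euler_poly i)^`()).[u] w.[u] w'.[u] w'^`().[u] => A A' x x' x''.
move=> ihu wW E1.
have E2 : W * (F' * (tau * x')) = A * (Rp.[u] * G u) + G u * A' - F * dW.
  by rewrite -E1 addrK.
transitivity (alpha * x * x' * (W * (F' * (tau * x'))) - i%:R * x' ^+ 2 * (W * F)); first by ring.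
rewrite E2 ihu.
transitivity (alpha * x * x' * (A * (Rp.[u] * G u) + G u * A') - alpha * x * F * (x' * dW)
   - i%:R * x' ^+ 2 * (A * G u)); first by ring.
rewrite wW.
transitivity (alpha * x * x' * (A * (Rp.[u] * G u) + G u * A') - 2 * i%:R * alpha * x * x'' * (W * F)
   - i%:R * x' ^+ 2 * (A * G u)); first by ring.
by rewrite ihu; ring.
Qed.

Hypothesis G_superpoly : forall N, exists2 c : R, 0 < c &
  exists u0 : R, forall u, u0 <= u -> c * u ^+ N <= G u.

(** [euler_polyE] and [euler_equation] express the same function, so that X1 G = X2 with
    polynomials X1 and X2 = w'^(2 k + 2) q(tau w).  Faster than polynomial growth of G forces X1 = 0,
    hence X2 = 0; but at large u neither w'(u) nor q(tau w(u)) vanishes. *)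
Lemma linear_ode_absurd : (1 < m)%N -> False.
Proof.
move=> m1.
pose q := euler_rest alpha k.+1 m.
have q0 : q != 0 by exact: euler_rest_neq0.
pose W := w' ^+ (2 * k.+1).
pose X1 := euler_poly k.+1 - W * (tau *: w) ^+ m.
pose X2 := W * (q \Po (tau *: w)).
have X12 u : X1.[u] * G u = X2.[u].
  have := euler_polyE k.+1 u; rewrite (euler_equation alpha01 km) -GE -/q -/W => h.
  rewrite /X1 /X2 hornerD hornerN mulrBl -h !(hornerM W) horner_comp hornerZ.
  move: W.[u] => W0; rewrite horner_exp hornerZ; move: q.[_] => q1; ring.
have X1_0 : X1 = 0.
  apply/eqP/negPn/negP => X1n0.
  have [d d0 [u0 H]] := poly_eventually_ge X1n0.
  have [B B0] := poly_le_pow X2; move: (size X2) => N X2le.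
  have [c c0 [u1 Gge]] := G_superpoly N.+1.
  pose u := Num.max (Num.max 1 (B / (d * c) + 1)) (Num.max u0 u1).
  have ug1 : 1 <= u by rewrite !le_max lexx.
  have uB : B / (d * c) < u.
    by rewrite !lt_max ltrDl ltr01 orbT.
  have uu0 : u0 <= u by rewrite !le_max lexx !orbT.
  have uu1 : u1 <= u by rewrite !le_max lexx !orbT.
  have u_gt0 : 0 < u by exact: lt_le_trans ug1.
  have un0 : 0 < u ^+ N by rewrite exprn_gt0.
  have h : d * (c * u ^+ N.+1) <= B * u ^+ N.
    apply: le_trans (X2le u ug1); rewrite -X12 normrM; apply: ler_pM.
    - exact: ltW.
    - by rewrite mulr_ge0 ?exprn_ge0 ?(ltW c0) ?(ltW u_gt0).
    - exact: H.
    - by apply: le_trans (ler_norm _); exact: Gge.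
  move: h; rewrite exprS mulrA mulrA ler_pM2r// leNgt mulrC -ltr_pdivrMr ?mulr_gt0//.
  by rewrite uB.
have X2_0 u : X2.[u] = 0 by rewrite -X12 X1_0 horner0 mul0r.
have [d d0 [x0 H]] := poly_eventually_ge q0.
have [d' d'0 [u0 H']] := poly_eventually_ge (deriv_jump_poly_neq0 lam0).
have [u1 H1] := jump_poly_unbounded lam0 (x0 / tau).
pose u := Num.max u0 u1.
have := X2_0 u; rewrite /X2 hornerM horner_exp horner_comp hornerZ => /eqP.
rewrite mulf_eq0 expf_eq0 => /orP[/andP[_ /eqP E0]|/eqP E0].
  have := H' u; rewrite E0 normr0 le_max lexx => /(_ isT).
  by rewrite leNgt d'0.
have := H (tau * w.[u]); rewrite E0 normr0.
rewrite mulrC -ler_pdivrMr// H1 ?le_max ?lexx ?orbT// => /(_ isT).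
by rewrite leNgt d0.
Qed.

End EulerElimination.

Section NonnegativeLogDerivative.
Context {R : realType}.
Variables (alpha tau : R) (k : nat) (lam : 'I_k.+1 -> R).
Hypothesis alpha01 : 0 < alpha < 1.
Hypothesis tau0 : 0 < tau.
Hypothesis lam0 : forall j, 0 < lam j.
Let a0 : 0 < alpha. Proof. by case/andP: alpha01. Qed.
Local Notation w := (jump_poly lam).
Local Notation E := (psum (ml_coef alpha)).
Variables (p r : R ^nat).
Hypothesis p_entire : entire p.
Hypothesis p_ge0 : forall n, 0 <= p n.
Hypothesis p0_gt0 : 0 < p 0%N.
Hypothesis r_ge0 : forall n, 0 <= r n.
Hypothesis pr : forall n, n.+1%:R * p n.+1 = \sum_(j < n.+1) r j * p (n - j)%N.
Hypothesis pE : forall u, psum p u = E (tau * w.[u]).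

Lemma generating_function_superpoly N : exists2 c : R, 0 < c &
  exists u0 : R, forall u, u0 <= u -> c * u ^+ N <= psum p u.
Proof.
have [c c0 [u0 wge]] := jump_poly_ge lam0.
exists (ml_coef alpha N * (tau * c) ^+ N).
  by rewrite mulr_gt0 ?ml_coef_gt0// exprn_gt0// mulr_gt0.
exists (Num.max 1 u0) => u; rewrite ge_max => /andP[u1 uu0].
have u_gt0 : 0 < u by lra.
have uk : u <= u ^+ k.+1 by rewrite -{1}(expr1 u) ler_weXn2l.
have cw : tau * c * u <= tau * w.[u].
  rewrite -mulrA ler_wpM2l ?(ltW tau0)//; apply: le_trans (wge u uu0).
  by rewrite ler_wpM2l// ltW.
have cu0 : 0 <= tau * c * u by rewrite !mulr_ge0// ltW.
rewrite pE -mulrA -exprMn.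
have tw0 : 0 <= tau * w.[u] by exact: le_trans cw.
apply: (@le_trans _ _ (ml_coef alpha N * (tau * w.[u]) ^+ N)).
  by rewrite ler_wpM2l ?(ltW (ml_coef_gt0 a0 _))// lerXn2r ?nnegrE.
exact: (term_le_psum N tw0 (ml_entire a0) (fun n => ltW (ml_coef_gt0 a0 n))).
Qed.

(** The exponent m of [exponent_eq] is at least 2, since alpha m = k + 1 >= 1 > alpha. *)
Lemma nonneg_log_deriv_absurd : False.
Proof.
have km := exponent_eq alpha01 tau0 lam0 p_entire p_ge0 p0_gt0 r_ge0 pr pE.
set m := Num.truncn _ in km.
have m1 : (1 < m)%N.
  rewrite ltnNge; apply/negP => m_le1.
  have : alpha * m%:R < 1.
    case/andP: alpha01 => h0 h1; apply: le_lt_trans h1.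
    by rewrite ler_piMr ?(ltW h0)// lern1.
  by rewrite km ltrn1.
apply: (@linear_ode_absurd _ alpha tau k m lam alpha01 tau0 lam0 km (psum p) (\poly_(i < m) r i) pE) => //.
- move=> u; apply: (is_derive_eq (psum_derive u p_entire)).
  exact: (psum_deriv alpha01 tau0 lam0 p_entire p_ge0 p0_gt0 r_ge0 pr pE).
- exact: generating_function_superpoly.
Qed.

End NonnegativeLogDerivative.

(** * State probabilities of the counting process *)

Section CountingProcess.
Context {d : measure_display} {T : measurableType d} {R : realType}.
Variables (P : probability T R) (alpha : R) (k : nat) (lam : 'I_k -> R).
Variable M : R -> {RV P >-> R}.
Hypothesis alpha01 : 0 < alpha < 1.
Hypothesis lam0 : forall j, 0 <= lam j.
Hypothesis gfcp : is_GFCP alpha lam M.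
Let a0 : 0 < alpha. Proof. by case/andP: alpha01. Qed.
Local Notation mu := (@lebesgue_measure R).
Local Notation p := (state_prob M).

Lemma state_prob_itv n t : 0 <= p n t <= 1.
Proof.
rewrite /state_prob fine_ge0//= -lee_fin fineK ?probability_le1//.
exact: fin_num_measure.
Qed.

Lemma measurable_state_prob n (t : R) : measurable_fun `]0, t[ (p n).
Proof.
apply: open_continuous_measurable_fun; first exact: interval_open.
move=> s; rewrite inE/= in_itv/= => /andP[s0 _].
have [_ ds _] := GFCP_caputo_derivable gfcp n.
by apply: differentiable_continuous; apply/derivable1_diffP; exact: ds.
Qed.

Lemma state_prob_volterra n t : 0 < t ->
  \int[mu]_(s in `]0, t[) ((t - s) `^ (alpha - 1) * rateop lam (p^~ s) n) =
  Gamma alpha * (p n t - (n == 0)%:R).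
Proof.
move=> t0; rewrite /Rintegral -(GFCP_init gfcp n).
transitivity (fine (Gamma alpha * (p n t - p n 0))%:E); last by [].
rewrite -(volterra alpha01 t0 (GFCP_caputo_derivable gfcp n)); congr fine.
apply: eq_integral => s; rewrite inE/= in_itv/= => /andP[s0 _].
by rewrite (GFCP_system gfcp).
Qed.

(** At a zero of p_0 the system says that the Caputo derivative of p_0 is 0, against
    [caputo_at_zero_lt0]. *)
Lemma state_prob0_gt0 t : 0 < t -> 0 < p 0 t.
Proof.
move=> t0; have /andP[p0 _] := state_prob_itv 0 t.
rewrite lt_neqAle p0 andbT eq_sym; apply/eqP => pt0.
have pge0 s : 0 < s < t -> 0 <= p 0 s by move=> _; have /andP[] := state_prob_itv 0 s.
have p00 : 0 < p 0 0 by rewrite (GFCP_init gfcp) ltr01.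
have := caputo_at_zero_lt0 alpha01 t0 (GFCP_caputo_derivable gfcp 0) pge0 pt0 p00.
by rewrite (GFCP_system gfcp)// pt0 mulr0 big_pred0// addr0 ltxx.
Qed.

Lemma state_prob_generating_function t u : 0 < t ->
  pseries (p^~ t) u @ \oo --> psum (ml_coef alpha) (t `^ alpha * (jump_poly lam).[u]).
Proof.
move=> t0.
pose b m := ml_coef alpha m * (t `^ alpha) ^+ m.
have bE x : pseries b x = pseries (ml_coef alpha) (t `^ alpha * x).
  apply/funext => N; apply: eq_bigr => m _.
  by rewrite /b /= exprMn !mulrA.
have -> : psum (ml_coef alpha) (t `^ alpha * (jump_poly lam).[u]) = psum b (jump_poly lam).[u].
  by rewrite /psum bE.
apply: generating_function => //.
- by move=> m; rewrite mulr_ge0 ?exprn_ge0 ?powR_ge0// ltW// ml_coef_gt0.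
- by move=> x; rewrite bE; exact: ml_entire.
move=> N n; rewrite /b -(powR_natM alpha t N).
under eq_bigr do rewrite -(powR_natM alpha t).
apply: (picard_error a0 lam0 (p := p)) => //.
- by move=> i s _; have /andP[h0 h1] := state_prob_itv i s; rewrite ger0_norm.
- by move=> i s _; exact: measurable_state_prob.
- exact: state_prob_volterra.
Qed.

Lemma distribution_nat_points t : 0 <= t -> distribution P (M t) (~` nat_points) = 0%E.
Proof.
move=> t0; rewrite /distribution /pushforward (_ : _ @^-1` _ = set0) ?measure0//.
apply/seteqP; split => // x /= h; apply: h.
by have /natrP[n ->] := GFCP_nat gfcp x t0; exists n.
Qed.

End CountingProcess.

Theorem proposition3p3 (d : measure_display) (T : measurableType d)
    (R : realType) (P : probability T R) (alpha : R) (k : nat)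
    (lam : 'I_k -> R) (M : R -> {RV P >-> R}) :
  0 < alpha < 1 ->
  (1 <= k)%N ->
  (forall j : 'I_k, 0 < lam j) ->
  is_GFCP alpha lam M ->
  forall t : R, 0 < t -> ~ infinitely_divisible (distribution P (M t)).
Proof.
case: k lam => // k lam alpha01 _ lam0 gfcp t t0 idiv.
have lam_ge0 j : 0 <= lam j by exact: ltW.
have p0 := state_prob0_gt0 alpha01 gfcp t0.
have gf u := state_prob_generating_function alpha01 lam_ge0 gfcp (u := u) t0.
have pt_root N : exists b, (forall j, 0 <= b j <= 1) /\
    forall n, state_prob M n t = cpow b N.+1 n.
  apply: (infinitely_divisible_cpow (mu := distribution P (M t))) => //.
  - exact: (distribution_nat_points gfcp (ltW t0)).
  - move: p0; rewrite /state_prob => p0.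
    rewrite -[X in (_ < X)%E]fineK ?lte_fin//; exact: fin_num_measure.
apply: (@nonneg_log_deriv_absurd _ alpha (t `^ alpha) k lam alpha01 _ lam0
  (state_prob M ^~ t) (log_deriv (state_prob M ^~ t))) => //.
- exact: powR_gt0.
- by move=> u; apply/cvg_ex; eexists; exact: gf.
- by move=> n; have /andP[] := state_prob_itv M n t.
- exact: log_deriv_ge0.
- by move=> n; apply: log_derivE; rewrite gt_eqF.
- by move=> u; exact: cvg_lim (gf u).
Qed.
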